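(* For all $n\ge2$ the bilinear Kakeya estimate $$K^*\Big(\frac{n+2}{n+1}\times\frac{n+2}{n+1}\to\frac{n+2}{2n}\Big)$$ holds.
   Context: Let $0<\delta\ll1$ be a small parameter. $A\lesssim B$ means that for every $\varepsilon>0$ there is a constant $C_\varepsilon$ independent of $\delta$ with $A\le C_\varepsilon\delta^{-\varepsilon}B$. All functions are non-negative. Let $\mathcal{E}$ be a $\delta$-net (maximal $\delta$-separated subset) of the cube $Q=[-1,1]^{n-1}\subset\mathbb{R}^{n-1}$. Equip $\mathcal{E}$ with two measures: counting measure $di$ and normalized counting measure $d\omega=\delta^{n-1}di$. For $\omega,i\in\mathcal{E}$ let $$T_\omega^i=\{(\underline{y},y_n)\in\mathbb{R}^{n-1}\times\mathbb{R}:|y_n|\le1,\ |\underline{y}-y_n\omega-i|\le\delta\}.$$ For $g$ on $\mathcal{E}\times\mathcal{E}$ put $$X^*g(x)=\sum_{\omega\in\mathcal{E}}\sum_{i\in\mathcal{E}}g(\omega,i)\chi_{T_\omega^i}(x).$$ The mixed norm is $\|g\|_{L^{a}_\omega L^b_i}=\big\|\,\|g(\omega,\cdot)\|_{L^b(di)}\big\|_{L^a(d\omega)}$. For $1\le p,q\le\infty$ with dual exponents $p',q'$, $K^*(q'\times q'\to\frac{p'}2)$ denotes the estimate $$\|X^*f\,X^*g\|_{L^{p'/2}(\mathbb{R}^n)}\lesssim\delta^{-\frac{2n}{p}+2}\|f\|_{L^{q'}_\omega L^1_i}\|g\|_{L^{q'}_\omega L^1_i}$$ for all $f,g$ supported on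 $\mathcal{E}_1\times\mathcal{E}$ and $\mathcal{E}_2\times\mathcal{E}$ respectively, where $\mathcal{E}_1,\mathcal{E}_2$ are $O(1)$-separated subsets of $\mathcal{E}$, i.e. the distance between them is comparable to $1$ (implied constants may depend on the comparability constant). The exponent $p'/2$ may be less than $1$. (In the claim, $p=\frac{n+2}{2}$ and $q=n+2$, so the power of $\delta$ is $\delta^{-\frac{4n}{n+2}+2}=\delta^{-2\frac{n-2}{n+2}}$.) The estimate is understood to hold for all small $\delta$ and all $\delta$-nets $\mathcal{E}$. *)

(* Defs.v *)
From HB Require Import structures.
From mathcomp Require Import all_boot all_order all_algebra finmap.
From mathcomp Require Import all_classical all_reals all_analysis.

Set Implicit Arguments.
Unset Strict Implicit.
Unset Printing Implicit Defensive.
Import Order.TTheory GRing.Theory Num.Theory.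
Import numFieldNormedType.Exports.

Local Open Scope classical_set_scope.
Local Open Scope ring_scope.

Section lebesgue_tuple.
Context {R : realType}.
Local Notation RR := (measurableTypeR R).

Definition tuple_cons n (p : RR * n.-tuple RR) : n.+1.-tuple RR :=
  [tuple of p.1 :: p.2].

Lemma measurable_tuple_cons n :
  measurable_fun [set: RR * n.-tuple RR] (@tuple_cons n).
Proof. exact: measurable_cons. Qed.

Section cons_measure.
Variables (n : nat) (mu : {sigma_finite_measure set (n.-tuple RR) -> \bar R}).

Definition cons_measure : set (n.+1.-tuple RR) -> \bar R :=
  pushforward (lebesgue_measure \x mu)%E (@tuple_cons n).

Let cons_measure0 : cons_measure set0 = 0%E.
Proof. by rewrite /cons_measure /pushforward preimage_set0 measure0. Qed.

Let cons_measure_ge0 A : (0 <= cons_measure A)%E.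
Proof. by rewrite /cons_measure /pushforward measure_ge0. Qed.

Let cons_measure_sigma_additive : semi_sigma_additive cons_measure.
Proof.
move=> F mF tF mUF; rewrite /cons_measure /pushforward preimage_bigcup.
have mcons A : measurable A -> measurable (@tuple_cons n @^-1` A).
  by move=> mA; rewrite -[X in measurable X]setTI; exact: measurable_tuple_cons.
apply: measure_semi_sigma_additive => [k||]; first exact: mcons.
- apply/trivIsetP => /= i j _ _ ij; rewrite -preimage_setI.
  by move/trivIsetP : tF => /(_ _ _ _ _ ij) ->//; rewrite preimage_set0.
- by rewrite -preimage_bigcup; exact: mcons.
Qed.

HB.instance Definition _ := isMeasure.Build _ _ _ cons_measure
  cons_measure0 cons_measure_ge0 cons_measure_sigma_additive.

Let cons_measure_sigma_finite : sigma_finite setT cons_measure.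
Proof.
have /sigma_finiteP[F [FT ndF Foo]] := sigma_finiteT (@lebesgue_measure R).
have /sigma_finiteP[G [GT ndG Goo]] := sigma_finiteT mu.
pose uncons (t : n.+1.-tuple RR) : RR * n.-tuple RR :=
  (thead t, [tuple of behead t]).
have consK : cancel (@tuple_cons n) uncons.
  by move=> [x t]; rewrite /uncons /tuple_cons theadE; congr pair; exact/val_inj.
have muncons : measurable_fun setT uncons.
  by apply: measurable_fun_pair; [exact: measurable_tnth|exact: measurable_behead].
exists (fun k => uncons @^-1` (F k `*` G k)).
  rewrite -preimage_bigcup (_ : \bigcup_k (F k `*` G k) = setT)//.
  rewrite -subTset => -[x y] _.
  have [[i _ Fx] [j _ Gy]] : (\bigcup_k F k) x /\ (\bigcup_k G k) y.
    by rewrite -FT -GT.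
  exists (maxn i j) => //; split => /=.
    by move: x Fx; exact/subsetPset/ndF/leq_maxl.
  by move: y Gy; exact/subsetPset/ndG/leq_maxr.
move=> k; have [mF Fk] := Foo k; have [mG Gk] := Goo k; split.
  by rewrite -[X in measurable X]setTI; apply: muncons => //; exact: measurableX.
rewrite /cons_measure /pushforward -comp_preimage.
have -> : uncons \o @tuple_cons n = id by apply/funext => p; exact: consK.
by rewrite preimage_id product_measure1E// lte_mul_pinfty// ge0_fin_numE.
Qed.

HB.instance Definition _ := Measure_isSigmaFinite.Build _ _ _ cons_measure
  cons_measure_sigma_finite.

End cons_measure.

(* Lebesgue measure on R^n: the image under [cons] of the product of the
   Lebesgue measures on R and R^(n-1); the unit point mass when n = 0. *)
Fixpoint lebesgue_tuple n : {sigma_finite_measure set (n.-tuple RR) -> \bar R} :=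
  match n with
  | 0 => \d_([tuple] : 0.-tuple RR)
  | n'.+1 => cons_measure (lebesgue_tuple n')
  end.

Lemma lebesgue_tuple_box n (A : 'I_n -> set RR) :
  (forall i, measurable (A i)) ->
  lebesgue_tuple n [set t | forall i, A i (tnth t i)] =
  (\prod_(i < n) lebesgue_measure (A i))%E.
Proof.
elim: n A => [|n IH] A mA /=.
  rewrite big_ord0 diracE mem_set//=; by case.
rewrite /cons_measure /pushforward big_ord_recl -IH//.
have mB : measurable [set t : n.-tuple RR | forall i, A (lift ord0 i) (tnth t i)].
  rewrite (_ : [set _ | _] = \big[setI/setT]_(i < n) ((fun t : n.-tuple RR => tnth t i) @^-1` A (lift ord0 i))).
    by apply: bigsetI_measurable => i _; rewrite -[X in measurable X]setTI; apply: measurable_tnth.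
  rewrite -bigcap_seq; apply/seteqP; split => t /= H; first by move=> i _; exact: H.
  by move=> i; apply: (H i); rewrite /= mem_index_enum.
rewrite -product_measure1E//; congr (_ _); apply/seteqP; split => -[x t] /=.
  by move=> H; split; [exact: (H ord0)|move=> i; have := H (lift ord0 i); rewrite /tuple_cons tnthS].
move=> [Hx Ht] i; case: (unliftP ord0 i) => [j ->|->] //.
by rewrite /tuple_cons tnthS.
Qed.

End lebesgue_tuple.

Section kakeya.
Context {R : realType}.

Definition enorm m (v : 'I_m -> R) : R := Num.sqrt (\sum_(j < m) v j ^+ 2).

Definition edist m (x y : m.-tuple R) : R :=
  enorm (fun j => tnth x j - tnth y j).

Definition set_dist m (A B : set (m.-tuple R)) : R :=
  inf [set edist a b | a in A & b in B].

Definition cube m : set (m.-tuple R) :=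
  [set x | forall j, `|tnth x j| <= 1].

Definition separated m (delta : R) (A : set (m.-tuple R)) :=
  forall x y, A x -> A y -> x != y -> delta <= edist x y.

Definition net m (delta : R) (A : set (m.-tuple R)) :=
  [/\ A `<=` @cube m, separated delta A &
      forall B : set (m.-tuple R),
        A `<=` B -> B `<=` @cube m -> separated delta B -> B = A].

(* The point (y_, y_n) of R^m * R is [y]. *)
Definition tube m (delta : R) (w i : m.-tuple R) : set (m.-tuple R * R) :=
  [set y | `|y.2| <= 1 /\
     enorm (fun j => tnth y.1 j - y.2 * tnth w j - tnth i j) <= delta].

(* A bounded separated set is finite, so nets can be given as finite sets. *)
Definition Xstar m (delta : R) (E : {fset m.-tuple R}) (g : E * E -> R)
    (x : m.-tuple R * R) : R :=
  \sum_(w : E) \sum_(i : E) g (w, i) * \1_(tube delta (val w) (val i)) x.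

(* L^a norm on a finite set with respect to c times counting measure (c > 0). *)
Definition finLnorm (T : finType) (c : R) (a : \bar R) (h : T -> R) : R :=
  match a with
  | r%:E => (c * \sum_(x : T) `|h x| `^ r) `^ r^-1
  | +oo%E => \big[Num.max/0]_(x : T) `|h x|
  | -oo%E => 0
  end.

Definition mixed_norm m (delta : R) (E : {fset m.-tuple R}) (a b : \bar R)
    (g : E * E -> R) : R :=
  finLnorm (delta ^+ m) a (fun w : E => finLnorm 1 b (fun i : E => g (w, i))).

(* [Kstar R n s r] is K*(s x s -> r) in R^n, for s and 2r in [1, +oo]; thus
   s = q', r = p'/2, and p is recovered as the conjugate exponent of 2r.
   [K] is the comparability constant of the distance between E1 and E2. As
   [inf set0 = 0], the lower bound K^-1 forces E1 and E2 to be nonempty; if one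
   of them is empty then f or g is 0 and the estimate is trivial. *)
Definition Kstar (n : nat) (s r : \bar R) : Prop :=
  let m := n.-1 in
  let p := hoelder_conjugate (2%:E * r)%E in
  exists2 delta0 : R, 0 < delta0 &
  forall K eps : R, 0 < K -> 0 < eps ->
  exists2 C : R, 0 < C &
  forall (delta : R) (E : {fset m.-tuple R}) (E1 E2 : {set E})
    (f g : E * E -> R),
  0 < delta < delta0 ->
  net delta [set` E] ->
  K^-1 <= set_dist [set val w | w in [set` E1]] [set val w | w in [set` E2]]
       <= K ->
  (forall z, 0 <= f z) -> (forall z, 0 <= g z) ->
  (forall w i, w \notin E1 -> f (w, i) = 0) ->
  (forall w i, w \notin E2 -> g (w, i) = 0) ->
  (Lnorm (lebesgue_tuple m \x lebesgue_measure) r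
     (fun x => (Xstar delta f x * Xstar delta g x)%:E)
   <= (C * delta `^ (- eps) * delta `^ (- (2 * n%:R * fine p^-1) + 2)
       * mixed_norm delta s 1 f * mixed_norm delta s 1 g)%:E)%E.

End kakeya.

Arguments Kstar R n s r : clear implicits.

(* Main.v *)
Require Import Defs.
From mathcomp Require Import all_boot all_order all_algebra finmap.
From mathcomp Require Import all_classical all_reals all_analysis.
From mathcomp Require Import measurable_realfun ring lra zify.

Set Implicit Arguments.
Unset Strict Implicit.
Unset Printing Implicit Defensive.
Import Order.TTheory GRing.Theory Num.Theory.
Import numFieldNormedType.Exports.

Local Open Scope ring_scope.

(** The theorem is a hairbrush argument; write m = n - 1, and let [d] be the
    width of the tubes.

    Suppose first that F = X*f and G = X*g have size about mu1 and mu2 on a set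
    of volume V.  Let N1, N2 be the total weights of f and g, let M bound the
    weight that g gives to the tubes of any one direction, and let lam be
    mu2 V / N2, about the average volume of the level set inside a tube of g.
    Most of G on the level set comes from tubes U of g that hold volume at least
    lam / 4 of it.  Since transverse tubes share only volume O(d^n), an average
    tube T of f meets such tubes of total weight H at least about
    mu1 mu2 V / (N1 d^n).  These tubes form the brush of T.  Only a part of
    volume lam / 8 of each lies within a distance rho ~ lam / d^m of T, because
    of transversality.  Two tubes of the brush that meet at distance rho from T
    have directions in a common slab of width d / rho around a line, so the
    L^2 norm of the brush away from T is controlled by counting net points in
    that slab: this costs rho^(2-n) M and a logarithm.  Cauchy-Schwarz then
    bounds H, which gives [level_estimate]:
    mu1 mu2 (mu2 V)^n <= C log(1/d) d^(1 + m n) N1 N2^n M.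
    When lam / d^m is less than a multiple of d no such rho exists, but then the
    trivial bounds mu1 <= N1 and mu2 <= C d^(-m) M suffice.

    Wolff avoids the loss rho^(2-n) by a further argument; here it is
    affordable, as it is exactly what separates the hairbrush bound from the
    exponent of the theorem.  Indeed the product of the estimate
    with the one where f and g are exchanged reads
    (mu1 mu2)^(n+2) V^(2n) <= C log^2 d^(2 + 2 m n) (N1^(n+1) M1) (N2^(n+1) M2).
    Splitting f dyadically by the weights a_w of its directions makes
    N1^(n+1) M1 = O((sum_w a_w^s)^(n+1)) with s = (n+2)/(n+1), and the
    inequality becomes the weak form of the theorem ([bilinear_level_estimate]).
    As the exponent (n+2)/(2n) is at most 1, its power is subadditive, and
    summing over the O(log(1/d)) pieces of f and g and over the dyadic level sets
    costs only powers of log(1/d), absorbed by d^(-eps).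

    All functions of the point depend only on which of finitely many sets contain
    it, so the integrals are finite sums over the cells that these sets cut out
    ([signature], [cell_vol]), and only the volumes of tubes and of intersections
    of two tubes are computed by Fubini ([sheared_slab_volume]). *)

(** * The hairbrush inequality for finitely many cells *)

Lemma weighted_Cauchy_Schwarz (R : realFieldType) (X : finType) (P : pred X)
    (v a : X -> R) :
  (forall x, 0 <= v x) -> 0 < \sum_(x | P x) v x ->
  (\sum_(x | P x) v x * a x) ^+ 2 <=
  (\sum_(x | P x) v x) * \sum_(x | P x) v x * a x ^+ 2.
Proof.
move=> v0; set V := \sum_(x | P x) v x; set A := \sum_(x | P x) _ * a x => V0.
set Q := \sum_(x | P x) _.
have : 0 <= \sum_(x | P x) v x * (V * a x - A) ^+ 2.
  by apply: sumr_ge0 => x _; rewrite mulr_ge0// sqr_ge0.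
have -> : \sum_(x | P x) v x * (V * a x - A) ^+ 2 = V * (V * Q - A ^+ 2).
  transitivity (\sum_(x | P x) (V ^+ 2 * (v x * a x ^+ 2)
      + - (2 * V * A) * (v x * a x) + A ^+ 2 * v x)).
    by apply: eq_bigr => x _; ring.
  rewrite !big_split/= -!mulr_sumr -/V -/A -/Q; ring.
by rewrite pmulr_rge0// subr_ge0.
Qed.

(** [X] is the set of cells, [v] their volumes and [B T] the cells of the tube
    [T]; [S] is a level set and [far T] the region away from [T].  [lam] is a
    lower bound for the average volume of [S] in a tube of [g]. *)
Section hairbrush.
Variables (R : realFieldType) (X I : finType) (v : X -> R).
Variables (B : I -> pred X) (S : pred X) (far : I -> pred X) (meets : rel I).
Variables (f g : I -> R) (mu1 mu2 lam kappa theta : R).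

Local Notation F x := (\sum_T f T * (B T x)%:R).
Local Notation G x := (\sum_U g U * (B U x)%:R).
Local Notation N1 := (\sum_T f T).
Local Notation N2 := (\sum_U g U).
Local Notation V := (\sum_(x | S x) v x).

Hypothesis v0 : forall x, 0 <= v x.
Hypothesis f0 : forall T, 0 <= f T.
Hypothesis g0 : forall U, 0 <= g U.
Hypothesis mu10 : 0 < mu1.
Hypothesis lam0 : 0 <= lam.
Hypothesis V0 : 0 < V.
Hypothesis theta0 : 0 <= theta.
Hypothesis kappa0 : 0 <= kappa.
Hypothesis FS : forall x, S x -> mu1 <= F x <= 2 * mu1.
Hypothesis GS : forall x, S x -> mu2 <= G x.
Hypothesis lamE : lam * N2 <= mu2 * V.
Hypothesis cross : forall T U, 0 < f T -> 0 < g U ->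
  \sum_(x | B T x && B U x) v x <= kappa * (meets T U)%:R.
Hypothesis near : forall T U, 0 < f T -> 0 < g U -> meets T U ->
  \sum_(x | B U x && ~~ far T x) v x <= lam / 8.
Hypothesis overlap : forall T U, 0 < f T -> 0 < g U -> meets T U ->
  \sum_(U' | meets T U') g U' * \sum_(x | [&& B U x, B U' x & far T x]) v x
    <= theta.

(** A tube is good when it holds a quarter of the average; [H T] is the weight of
    the brush that the good tubes form around [T]. *)
Let good U := lam / 4 <= \sum_(x | B U x && S x) v x.
Let H T := \sum_(U | good U && meets T U) g U.

Let sum_bool (P Q : pred X) (a : X -> R) :
  \sum_(x | P x) a x * (Q x)%:R = \sum_(x | P x && Q x) a x.
Proof.
by rewrite big_mkcondr; apply: eq_bigr => x _; case: (Q x);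
  rewrite ?mulr1 ?mulr0.
Qed.

Let bad_le : \sum_(x | S x) v x * \sum_(U | ~~ good U) g U * (B U x)%:R
  <= mu2 * V / 4.
Proof.
under eq_bigr do rewrite mulr_sumr.
rewrite exchange_big/=.
apply: (@le_trans _ _ (\sum_(U | ~~ good U) g U * (lam / 4))).
  apply: ler_sum => U bU.
  under eq_bigr do rewrite mulrCA.
  rewrite -mulr_sumr ler_wpM2l// sum_bool.
  by under eq_bigl do rewrite andbC; rewrite ltW// ltNge.
rewrite -mulr_suml.
have : \sum_(U | ~~ good U) g U <= N2.
  by rewrite [leRHS](bigID good)/= lerDr sumr_ge0.
move=> /(ler_wpM2r lam0); move: lamE; lra.
Qed.

Let good_ge : mu1 * mu2 * V / 2 <=
  \sum_(x | S x) v x * (F x * \sum_(U | good U) g U * (B U x)%:R).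
Proof.
have G0 x (P : pred I) : 0 <= \sum_(U | P U) g U * (B U x)%:R.
  by apply: sumr_ge0 => U _; rewrite mulr_ge0.
have : mu1 * (mu2 * V) <= \sum_(x | S x) v x * (F x * G x).
  rewrite mulrA mulr_sumr; apply: ler_sum => x Sx; rewrite mulrC ler_wpM2l//.
  have /andP[F1 _] := FS Sx.
  apply: (@le_trans _ _ (mu1 * G x)); last exact: ler_wpM2r.
  by rewrite ler_wpM2l ?GS// ltW.
have GE x : v x * (F x * G x) =
    v x * (F x * \sum_(U | good U) g U * (B U x)%:R) +
    v x * (F x * \sum_(U | ~~ good U) g U * (B U x)%:R).
  by rewrite -mulrDr -mulrDr; congr (_ * (_ * _)); rewrite (bigID good).
rewrite (eq_bigr _ (fun x _ => GE x)) big_split/= => h.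
have h2 : \sum_(x | S x) v x * (F x * \sum_(U | ~~ good U) g U * (B U x)%:R)
    <= 2 * mu1 * (mu2 * V / 4).
  apply: le_trans (_ : _ <= 2 * mu1 * (\sum_(x | S x)
    v x * \sum_(U | ~~ good U) g U * (B U x)%:R)) _; last first.
    by rewrite ler_wpM2l// mulr_ge0// ltW.
  rewrite mulr_sumr; apply: ler_sum => x Sx; rewrite mulrCA.
  have /andP[_ F2] := FS Sx.
  by rewrite ler_wpM2r// mulr_ge0.
rewrite -[_ / 2](addrK (2 * mu1 * (mu2 * V / 4))).
by rewrite lerBlDr; apply: le_trans (lerD (lexx _) h2); apply: le_trans h; lra.
Qed.

Let good_le :
  \sum_(x | S x) v x * (F x * \sum_(U | good U) g U * (B U x)%:R) <=
  kappa * \sum_T f T * H T.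
Proof.
under eq_bigr => x _.
  rewrite mulr_suml mulr_sumr.
  under eq_bigr => T _ do rewrite mulr_sumr mulr_sumr.
  over.
rewrite exchange_big/= mulr_sumr; apply: ler_sum => T _.
rewrite exchange_big/=.
have [fT|fT] := ltP 0 (f T); last first.
  have -> : f T = 0 by apply/le_anti; rewrite fT f0.
  rewrite mul0r mulr0 big1// => U _.
  by rewrite big1// => x _; rewrite !(mul0r, mulr0).
have H' : f T * H T = \sum_(U | good U) f T * g U * (meets T U)%:R.
  rewrite /H mulr_sumr big_mkcondr; apply: eq_bigr => U _.
  by case: ifP; rewrite ?mulr1 ?mulr0.
rewrite H' mulr_sumr; apply: ler_sum => U _.
have [gU|gU] := ltP 0 (g U); last first.
  have -> : g U = 0 by apply/le_anti; rewrite gU g0.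
  by rewrite !(mul0r, mulr0) big1// => x _; rewrite !(mul0r, mulr0).
have -> : kappa * (f T * g U * (meets T U)%:R)
  = f T * g U * (kappa * (meets T U)%:R) by ring.
apply: le_trans (_ : _ <= f T * g U * \sum_(x | B T x && B U x) v x) _; last first.
  by rewrite ler_wpM2l ?cross ?mulr_ge0.
rewrite mulr_sumr [leRHS]big_mkcond/= big_mkcond/=.
apply: ler_sum => x _; case: (S x); case: (B T x); case: (B U x) => //=;
  rewrite ?mulr0 ?mul0r ?mulr0 ?mulr1 ?mul0r ?mulr_ge0//; lra.
Qed.

(** Each good tube of the brush keeps volume lam / 8 of the level set far from
    [T], hence lam / 8 * H T is at most the integral of the brush over the far
    part of the level set.  By Cauchy-Schwarz its square is at most [V] times the
    overlaps of pairs of tubes of the brush, and these sum to at most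
    H T * theta. *)
Let brush T : 0 < f T -> H T * lam ^+ 2 <= 64 * V * theta.
Proof.
move=> fT.
pose P x := \sum_(U | good U && meets T U) g U * (B U x)%:R.
have P0 x : 0 <= P x by apply: sumr_ge0 => U _; rewrite mulr_ge0.
have H0 : 0 <= H T by apply: sumr_ge0.
have [HT|HT] := ltP 0 (H T); last first.
  have -> : H T = 0 by apply/le_anti; rewrite HT H0.
  by rewrite mul0r !mulr_ge0// ltW.
have lower : lam / 8 * H T <= \sum_(x | S x) v x * (P x * (far T x)%:R).
  rewrite mulr_sumr; under [leRHS]eq_bigr do rewrite mulr_suml mulr_sumr.
  rewrite exchange_big/=; apply: ler_sum => U /andP[gdU mTU].
  have [gU|gU] := ltP 0 (g U); last first.
    have -> : g U = 0 by apply/le_anti; rewrite gU g0.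
    by rewrite mulr0 big1// => x _; rewrite !(mul0r, mulr0).
  under eq_bigr do rewrite -mulrA mulrCA.
  rewrite -mulr_sumr mulrC ler_wpM2l//.
  have nr := near fT gU mTU.
  have : lam / 4 <= \sum_(x | S x) v x * ((B U x)%:R * (far T x)%:R) + lam / 8.
    apply: le_trans gdU _; apply: le_trans (lerD (lexx _) nr).
    rewrite big_mkcond/= [X in X + _]big_mkcond/= [X in _ + X]big_mkcond/=.
    rewrite -big_split/=; apply: ler_sum => x _.
    by have := v0 x; case: (B U x); case: (S x); case: (far T x) => /=; lra.
  lra.
have upper : \sum_(x | S x) v x * (P x * (far T x)%:R) ^+ 2 <= H T * theta.
  apply: (@le_trans _ _ (\sum_x v x * (P x * (far T x)%:R) ^+ 2)).
    by rewrite [leRHS](bigID S)/= lerDl sumr_ge0// => x _; rewrite mulr_ge0// sqr_ge0.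
  rewrite {1}/H mulr_suml.
  rewrite (_ : \sum_x _ = \sum_(U | good U && meets T U) g U *
      \sum_(U' | good U' && meets T U') g U' *
         \sum_(x | [&& B U x, B U' x & far T x]) v x); last first.
    transitivity (\sum_x \sum_(U | good U && meets T U)
        \sum_(U' | good U' && meets T U')
          g U * (g U' * (v x * [&& B U x, B U' x & far T x]%:R))).
      apply: eq_bigr => x _; rewrite exprMn expr2 mulr_suml mulr_suml mulr_sumr.
      apply: eq_bigr => U _; rewrite mulr_sumr mulr_suml mulr_sumr.
      apply: eq_bigr => U' _.
      by case: (B U x); case: (B U' x); case: (far T x) => //=; ring.
    rewrite exchange_big/=; apply: eq_bigr => U _.
    rewrite exchange_big/= mulr_sumr; apply: eq_bigr => U' _.
    by rewrite -mulr_sumr -mulr_sumr sum_bool.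
  apply: ler_sum => U /andP[_ mTU].
  have [gU|gU] := ltP 0 (g U); last first.
    have -> : g U = 0 by apply/le_anti; rewrite gU g0.
    by rewrite !mul0r.
  rewrite ler_wpM2l//; apply: le_trans (overlap fT gU mTU).
  rewrite big_mkcondl/=; apply: ler_sum => U' _; case: ifP => // _.
  by rewrite mulr_ge0// sumr_ge0.
have CS := weighted_Cauchy_Schwarz (fun x => P x * (far T x)%:R) v0 V0.
have : (lam / 8 * H T) ^+ 2 <= V * (H T * theta).
  apply: le_trans (le_trans CS _); last by rewrite ler_wpM2l// ltW.
  have l0 : 0 <= lam / 8 * H T by rewrite mulr_ge0// divr_ge0.
  by rewrite ler_sqr// nnegrE// (le_trans l0).
by move=> h; rewrite -(ler_pM2r HT); lra.
Qed.

(** The bad tubes carry at most half of the integral of F G over the level set.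
    The other half is at most kappa times the sum of [f T * H T], and [brush]
    bounds [H T] for every [T], so that no particular tube has to be chosen. *)
Lemma hairbrush : mu1 * mu2 * lam ^+ 2 <= 128 * kappa * theta * N1.
Proof.
rewrite -(ler_pM2r V0).
have h := le_trans good_ge good_le.
have : kappa * (\sum_T f T * H T) * lam ^+ 2 <=
    kappa * (\sum_T f T * (64 * V * theta)).
  rewrite -mulrA ler_wpM2l// mulr_suml; apply: ler_sum => T _.
  have [fT|fT] := ltP 0 (f T); last first.
    have -> : f T = 0 by apply/le_anti; rewrite fT f0.
    by rewrite !mul0r.
  by rewrite -mulrA ler_wpM2l// brush.
have := ler_wpM2r (sqr_ge0 lam) h.
rewrite -mulr_suml; lra.
Qed.

End hairbrush.

(** * Counting separated points near a line *)

(** Cells of the integer lattice are coded by sign and absolute value, so that a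
    weight that depends only on absolute values sums to a product over the
    coordinates; the factor 2 pays for the sign. *)
Lemma sum_box (R : realFieldType) (m N : nat) (W : finType) (P : pred W)
    (z : W -> 'I_m -> int) (phi : 'I_m -> nat -> R) :
  (forall k b, 0 <= phi k b) ->
  (forall x k, (`|z x k| <= N)%N) ->
  (forall x y, P x -> P y -> z x =1 z y -> x = y) ->
  \sum_(x | P x) \prod_k phi k `|z x k|%N <=
  \prod_k (2 * \sum_(b < N.+1) phi k b).
Proof.
move=> phi0 zN zinj.
pose code x := [ffun k => (z x k < 0, inord `|z x k| : 'I_N.+1)].
have code_inj : {in P &, injective code}.
  move=> x y Px Py /ffunP e; apply: zinj => // k; have := e k; rewrite !ffunE => -[e1].
  move=> /(congr1 val); rewrite /= !inordK ?ltnS// => e2.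
  by move: e1 e2; case: (z x k) => a; case: (z y k) => b //=; lia.
have prodE : \prod_k (2 * \sum_(b < N.+1) phi k b) =
    \sum_(h : {ffun 'I_m -> bool * 'I_N.+1}) \prod_k phi k (h k).2.
  rewrite -(bigA_distr_bigA (fun k (h : bool * 'I_N.+1) => phi k h.2)).
  apply: eq_bigr => k _.
  rewrite -(pair_bigA _ (fun (s : bool) (b : 'I_N.+1) => phi k b))/=.
  by rewrite big_const card_bool/= addr0 mulr_natl mulr2n.
rewrite prodE.
have -> : \sum_(x | P x) \prod_k phi k `|z x k|%N =
    \sum_(x in P) \prod_k phi k (code x k).2.
  apply: eq_bigr => x _; apply: eq_bigr => k _.
  by rewrite ffunE/= inordK ?ltnS.
rewrite -(big_imset (fun h : {ffun 'I_m -> bool * 'I_N.+1} =>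
  \prod_k phi k (h k).2) code_inj)/=.
rewrite [leRHS](bigID (mem [set code x | x in P]))/= lerDl.
by apply: sumr_ge0 => h _; apply: prodr_ge0.
Qed.

Lemma harmonic_sum_le (R : realFieldType) (L : nat) :
  \sum_(b < 2 ^ L) (b.+1%:R : R)^-1 <= L.+1%:R.
Proof.
elim: L => [|L IH]; first by rewrite big_ord_recl big_ord0 invr1 addr0.
rewrite expnS mul2n -addnn big_split_ord/= -(addn1 L.+1) natrD lerD//.
apply: (@le_trans _ _ (\sum_(b < 2 ^ L) ((2 ^ L)%:R : R)^-1)).
  apply: ler_sum => b _; rewrite lef_pV2 ?posrE ?ltr0n ?expn_gt0// ler_nat.
  by rewrite -addnS leq_addr.
by rewrite sumr_const card_ord -[leLHS]mulr_natl mulfV// pnatr_eq0 expn_eq0.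
Qed.

Lemma sum_indicator_le (R : realFieldType) (N M : nat) :
  \sum_(b < N) (b < M)%N%:R <= M%:R :> R.
Proof.
suff -> : \sum_(b < N) (b < M)%N%:R = (minn N M)%:R :> R by rewrite ler_nat geq_minr.
elim: N => [|N IH]; first by rewrite big_ord0 min0n.
by rewrite big_ord_recr/= IH -natrD; congr (_%:R); case: ltnP => /=; lia.
Qed.

Lemma absz_floor_le (R : realType) (y : R) : `|Num.floor y|%N%:R <= `|y| + 1.
Proof.
rewrite natr_absz intr_norm; have /andP[] := floor_itv y.
rewrite intrD; have := ler_norm (- y); have := ler_norm y.
by rewrite normrN ler_norml; lra.
Qed.

Section grid.
Variables (R : realType) (m : nat) (W : finType) (w : W -> 'I_m -> R).
Variables (d : R) (L : nat).
Hypothesis d0 : 0 < d.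
Hypothesis dL : 1 <= d * 2 ^+ L.
Hypothesis w1 : forall x k, `|w x k| <= 1.
Hypothesis w_sep : forall x y, x != y ->
  d <= Num.sqrt (\sum_k (w x k - w y k) ^+ 2).

(** The mesh is small enough for a sheared cube of side [q] to have diameter less
    than [d]. *)
Let q := d / (2 * m%:R).

(** The shear along coordinate [j] with slopes at most 1 at most doubles the
    differences of coordinates, so two points in the same sheared cell of side [q]
    would be closer than [d]. *)
Let grid_sum (N : nat) (P : pred W) (j : 'I_m) (s c : 'I_m -> R)
    (z := fun x k => Num.floor ((w x k - c k - s k * (w x j - c j)) / q))
    (phi : 'I_m -> nat -> R) :
  s j = 0 -> (forall k, `|s k| <= 1) -> (forall k, `|c k| <= 1) ->
  (forall k b, 0 <= phi k b) -> 8 * m%:R / d + 1 <= N%:R ->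
  \sum_(x | P x) \prod_k phi k `|z x k|%N <=
  \prod_k (2 * \sum_(b < N.+1) phi k b).
Proof.
move=> sj s1 c1 phi0 Nbig.
have m0 : 0 < m%:R :> R by rewrite ltr0n (leq_ltn_trans _ (ltn_ord j)).
have q0 : 0 < q by rewrite divr_gt0// mulr_gt0.
apply: sum_box => //.
  move=> x k; rewrite /z -(ler_nat R) natr_absz intr_norm.
  set Y := w x k - _ - _.
  have Y4 : `|Y| <= 4.
    have wc k' : `|w x k' - c k'| <= 2.
      by rewrite (le_trans (ler_normB _ _))// (_ : 2 = 1 + 1)// lerD.
    rewrite (le_trans (ler_normB _ _))// (_ : 4 = 2 + 1 * 2); last by ring.
    by rewrite lerD// normrM ler_pM.
  have Yq : `|Y / q| <= 8 * m%:R / d.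
    rewrite normrM normfV (gtr0_norm q0) ler_pdivrMr// /q.
    by rewrite (_ : 8 * _ / _ * _ = 4)//; field; rewrite !gt_eqF.
  have := absz_floor_le (Y / q); rewrite natr_absz intr_norm.
  by move: Yq Nbig; rewrite /Y; lra.
move=> x y _ _ zxy; apply/eqP/negP => /negP xy; have := w_sep xy.
apply/negP; rewrite -ltNge -(ger0_norm (ltW d0)) -sqrtr_sqr ltr_sqrt ?exprn_gt0//.
have close k : `|(w x k - c k - s k * (w x j - c j))
    - (w y k - c k - s k * (w y j - c j))| < q.
  have := zxy k; rewrite /z => e.
  have := floor_itv ((w x k - c k - s k * (w x j - c j)) / q).
  have := floor_itv ((w y k - c k - s k * (w y j - c j)) / q).
  rewrite -e intrD !ler_pdivlMr// !ltr_pdivrMr// ltr_norml.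
  move=> /andP[a1 a2] /andP[a3 a4]; apply/andP; split; lra.
have cj : `|w x j - w y j| < q.
  by have := close j; rewrite sj !mul0r !subr0 opprB addrA subrK.
have ck k : `|w x k - w y k| < 2 * q.
  rewrite (_ : w x k - w y k = (w x k - c k - s k * (w x j - c j))
    - (w y k - c k - s k * (w y j - c j)) + s k * (w x j - w y j)); last by ring.
  rewrite (le_lt_trans (ler_normD _ _))// (_ : 2 * q = q + q); last by ring.
  rewrite ltr_leD// normrM -(mul1r q) ler_pM// ltW//.
apply: (@lt_le_trans _ _ (\sum_(k < m) (2 * q) ^+ 2)).
  apply: ltr_sum => [|k _]; first by apply/hasP; exists j => //; rewrite mem_index_enum.
  by rewrite -real_normK ?num_real// ltr_pXn2r ?nnegrE// mulr_ge0// ltW.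
rewrite sumr_const card_ord -[leLHS]mulr_natl /q.
have -> : m%:R * (2 * (d / (2 * m%:R))) ^+ 2 = d ^+ 2 / m%:R by field; rewrite gt_eqF.
by rewrite ler_pdivrMr// ler_peMr ?sqr_ge0// ler1n -(ltr0n R).
Qed.

(** The points are within [A] of an affine line parametrised by coordinate [j].
    Transversally to [j] there are about A / d cells in each of m - 1 directions;
    along [j] the weight d / (d + distance) decays like the reciprocal of the
    index of the cell, and the harmonic sum over at most a multiple of 2^L cells
    contributes the factor L. *)
Lemma slab_sum (A : R) (P : pred W) (j : 'I_m) (s c : 'I_m -> R) :
  0 <= A -> s j = 0 -> (forall k, `|s k| <= 1) -> (forall k, `|c k| <= 1) ->
  (forall x k, P x -> k != j ->
     `|w x k - c k - s k * (w x j - c j)| <= A) ->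
  \sum_(x | P x) d / (d + `|w x j - c j|) <=
  4 * m%:R * (L + 8 * m + 3)%:R * (4 * m%:R * A / d + 4) ^+ m.-1.
Proof.
move=> A0 sj s1 c1 PA.
have mN0 : (0 < m)%N by apply: leq_ltn_trans (ltn_ord j).
have m0 : 0 < m%:R :> R by rewrite ltr0n.
have q0 : 0 < q by rewrite divr_gt0// mulr_gt0.
pose e := (L + 8 * m + 2)%N; pose N := (2 ^ e).-1.
have N1 : N.+1 = (2 ^ e)%N by rewrite prednK// expn_gt0.
pose M := (Num.truncn (A / q)).+2.
(* Weight of a cell: harmonic along [j], indicator of the slab elsewhere. *)
pose phi (k : 'I_m) (b : nat) : R := if k == j then b.+1%:R^-1 else (b < M)%N%:R.
have phi0 k b : 0 <= phi k b by rewrite /phi; case: ifP.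
have Nbig : 8 * m%:R / d + 1 <= N%:R.
  have -> : N%:R = 2 ^+ L * (2 ^ (8 * m))%N%:R * 4 - 1 :> R.
    apply/eqP; rewrite eq_sym subr_eq natr1 N1.
    rewrite (_ : (2 ^ e)%N = (2 ^ L * 2 ^ (8 * m) * 4)%N).
      by rewrite natrM (natrM _ (2 ^ L)%N) (natrX _ 2 L).
    by rewrite /e (expnD 2 (L + 8 * m) 2) (expnD 2 L).
  have dV : d^-1 <= 2 ^+ L by rewrite -(ler_pM2l d0) mulfV ?gt_eqF.
  have L1 : 1 <= 2 ^+ L :> R by rewrite exprn_ege1// ler1n.
  have : (8 * m)%:R + 1 <= (2 ^ (8 * m))%N%:R :> R.
    by rewrite natr1 ler_nat ltn_expl.
  rewrite natrM => h8.
  have : (8 * m%:R + 1) * 2 ^+ L <= (2 ^ (8 * m))%N%:R * 2 ^+ L :> R.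
    by rewrite ler_wpM2r// (le_trans _ L1).
  have := ler_wpM2l (ltW m0) dV.
  move: h8 L1; set T := (2 ^ (8 * m))%N%:R; nra.
have AqE : A / q = 2 * m%:R * A / d by rewrite /q; field; rewrite !gt_eqF.
have ME : M%:R <= 2 * m%:R * A / d + 2.
  rewrite /M -addn2 natrD lerD2r -AqE truncn_le.
  by rewrite divr_ge0// ltW.
have := grid_sum P sj s1 c1 phi0 Nbig.
set z := (fun x k => `|Num.floor ((w x k - c k - s k * (w x j - c j)) / q)|%N).
move=> main; apply: (@le_trans _ _ (2 * m%:R *
    \sum_(x | P x) \prod_k phi k (z x k))).
  rewrite mulr_sumr; apply: ler_sum => x Px.
  rewrite (bigD1 j)//= big1 ?mulr1 => [|k kj]; last first.
    rewrite /phi (negbTE kj) /z (_ : (_ < M)%N)// -(ltr_nat R).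
    apply: (le_lt_trans (absz_floor_le _)).
    rewrite /M -(natr1 _.+1) ltrD2r.
    apply: (@le_lt_trans _ _ (A / q)).
      rewrite normrM normfV (gtr0_norm q0) ler_wpM2r ?invr_ge0 ?(ltW q0)//.
      exact: PA.
    by have /andP[] := truncn_itv (divr_ge0 A0 (ltW q0)).
  rewrite /phi eqxx.
  rewrite ler_pdivrMr ?ltr_wpDr// mulrAC ler_pdivlMr//.
  have : (z x j)%:R <= `|w x j - c j| / q + 1.
    have := absz_floor_le ((w x j - c j - s j * (w x j - c j)) / q).
    by rewrite /z sj !mul0r !subr0 normrM normfV (gtr0_norm q0).
  rewrite -natr1 => /(ler_wpM2l (ltW d0)).
  rewrite mulrDr (_ : d * (_ / q) = 2 * m%:R * `|w x j - c j|); last first.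
    by rewrite /q; field; rewrite !gt_eqF.
  have : d <= m%:R * d by rewrite ler_peMl ?(ltW d0)// ler1n.
  lra.
have -> : 4 * m%:R * (L + 8 * m + 3)%:R * (4 * m%:R * A / d + 4) ^+ m.-1 =
    2 * m%:R * (2 * (L + 8 * m + 3)%:R * (4 * m%:R * A / d + 4) ^+ m.-1) :> R.
  by ring.
rewrite ler_wpM2l ?mulr_ge0//; apply: le_trans main _.
rewrite (bigD1 j)//= ler_pM//.
- by rewrite mulr_ge0// sumr_ge0.
- by apply: prodr_ge0 => k _; rewrite mulr_ge0// sumr_ge0.
- rewrite ler_wpM2l// /phi eqxx N1 (le_trans (harmonic_sum_le _ _))//.
  by rewrite ler_nat /e; lia.
rewrite (_ : _ ^+ m.-1 = \prod_(k < m | k != j) (4 * m%:R * A / d + 4)).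
  apply: ler_prod => k kj; rewrite mulr_ge0 ?sumr_ge0//=.
  rewrite /phi (negbTE kj); have := sum_indicator_le R N.+1 M; move: ME; lra.
by rewrite prodr_const cardC1 card_ord.
Qed.

Lemma separated_card_le : (0 < m)%N -> d <= 1 -> #|W|%:R <= (22 * m%:R / d) ^+ m.
Proof.
move=> mN0 d1; pose j := Ordinal mN0.
have m0 : 0 < m%:R :> R by rewrite ltr0n.
have m1 : 1 <= m%:R :> R by rewrite ler1n.
have q0 : 0 < q by rewrite divr_gt0// mulr_gt0.
have dV : 1 <= d^-1 by rewrite invf_ge1.
have mdV : 1 <= m%:R / d by rewrite mulr_ege1.
pose N := (Num.truncn (8 * m%:R / d + 1)).+1.
have md0 : 0 <= 8 * m%:R / d + 1 by rewrite addr_ge0// divr_ge0 ?mulr_ge0// ltW.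
have Nbig : 8 * m%:R / d + 1 <= N%:R.
  by have /andP[_ /ltW] := truncn_itv md0.
have NE : N.+1%:R <= 11 * (m%:R / d).
  rewrite /N -2!natr1; have := truncn_le (8 * m%:R / d + 1); rewrite md0.
  lra.
have := @grid_sum N predT j (fun=> 0) (fun=> 0) (fun _ _ => 1) erefl.
rewrite normr0 => /(_ (fun=> ler01) (fun=> ler01) (fun _ _ => ler01) Nbig).
rewrite [X in X <= _ -> _](_ : _ = #|W|%:R); last first.
  by rewrite -sumr_const; apply: eq_big => // x _; rewrite big1.
move=> /le_trans; apply; rewrite prodr_const !sumr_const !card_ord.
have h : 2 * N.+1%:R <= 22 * m%:R / d by move: NE; lra.
by rewrite ler_pXn2r// nnegrE ?mulr_ge0 ?invr_ge0// ltW.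
Qed.

End grid.

(** * Dyadic decompositions of power sums *)

Lemma powR_subadd (R : realType) (r x y : R) : 0 < r <= 1 -> 0 <= x -> 0 <= y ->
  (x + y) `^ r <= x `^ r + y `^ r.
Proof.
move=> /andP[r0 r1] x0 y0.
have [xy|xy] := eqVneq (x + y) 0.
  have /andP[/eqP -> /eqP ->] : (x == 0) && (y == 0) by rewrite -paddr_eq0// xy.
  by rewrite addr0 lerDl powR_ge0.
have s0 : 0 < x + y by rewrite lt_neqAle eq_sym xy addr_ge0.
have step t : 0 <= t -> t <= x + y -> t / (x + y) <= (t / (x + y)) `^ r.
  move=> t0 ts; have [->|tn0] := eqVneq t 0; first by rewrite mul0r powR_ge0.
  apply: ger1_powR => //; apply/andP; split.
    by rewrite divr_gt0// lt_neqAle eq_sym tn0.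
  by rewrite ler_pdivrMr// mul1r.
have scale t : 0 <= t -> t `^ r = (x + y) `^ r * (t / (x + y)) `^ r.
  move=> t0; rewrite -powRM ?(ltW s0) ?divr_ge0 ?(ltW s0)//.
  by rewrite mulrCA mulfV ?mulr1// gt_eqF.
rewrite (scale x)// (scale y)// -mulrDr ler_peMr ?powR_ge0//.
have -> : 1 = x / (x + y) + y / (x + y) by rewrite -mulrDl mulfV.
by apply: lerD; apply: step => //; rewrite ?lerDl ?lerDr.
Qed.

Lemma powR_sum_le (R : realType) (I : finType) (r : R) (P : pred I) (x : I -> R) :
  0 < r <= 1 -> (forall i, 0 <= x i) ->
  (\sum_(i | P i) x i) `^ r <= \sum_(i | P i) x i `^ r.
Proof.
move=> r01 x0; suff [] : 0 <= \sum_(i | P i) x i /\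
    (\sum_(i | P i) x i) `^ r <= \sum_(i | P i) x i `^ r by [].
elim/big_ind2 : _ => [|a1 b1 a2 b2 [a10 h1] [a20 h2]|i _].
- by rewrite powR0// gt_eqF//; case/andP: r01.
- split; first exact: addr_ge0.
  by apply: le_trans (powR_subadd r01 a10 a20) _; exact: lerD.
- by [].
Qed.

Lemma dyadic_band (R : realFieldType) (J : nat) (N x : R) : x <= N ->
  x <= N / 2 ^+ J \/ exists a : 'I_J, N / 2 ^+ a.+1 < x <= N / 2 ^+ a.
Proof.
move=> xN; elim: J => [|J [h|[a ha]]]; first by left; rewrite expr0 divr1.
- have [h'|h'] := leP x (N / 2 ^+ J.+1); first by left.
  by right; exists ord_max; rewrite /= h' h.
- by right; exists (widen_ord (leqnSn J) a).
Qed.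

(** Only about [J]^2 pairs of dyadic levels below [N1] and [N2] matter;
    where one of [F], [G] falls below 2^-J of its bound, the crude bound by the
    total mass is good enough. *)
Lemma sum_powR_le_levels (R : realType) (S : finType) (v F G : S -> R)
    (N1 N2 r B : R) (J : nat) :
  (forall s, 0 <= v s) -> (forall s, 0 <= F s <= N1) ->
  (forall s, 0 <= G s <= N2) -> 0 <= N1 -> 0 <= N2 -> 0 < r -> 0 <= B ->
  (forall mu1 mu2, 0 < mu1 -> 0 < mu2 -> (mu1 * mu2) `^ r *
    \sum_(s | (mu1 < F s <= 2 * mu1) && (mu2 < G s <= 2 * mu2)) v s <= B) ->
  \sum_s v s * (F s * G s) `^ r <=
  J%:R ^+ 2 * 4 `^ r * B + (\sum_s v s) * (N1 * N2 / 2 ^+ J) `^ r.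
Proof.
move=> v0 FN GN N10 N20 r0 B0 lev.
pose mu (N : R) (a : 'I_J) := N / 2 ^+ a.+1.
pose lv a b s := (mu N1 a < F s <= 2 * mu N1 a) && (mu N2 b < G s <= 2 * mu N2 b).
pose tail := (N1 * N2 / 2 ^+ J) `^ r.
have mu_ge0 N a : 0 <= N -> 0 <= mu N a by move=> h; rewrite divr_ge0// exprn_ge0.
have mu2E N a : 2 * mu N a = N / 2 ^+ a.
  by rewrite /mu exprS; field; rewrite expf_neq0.
have term_ge0 a b s : 0 <= (4 * (mu N1 a * mu N2 b)) `^ r * (lv a b s)%:R.
  by rewrite mulr_ge0// powR_ge0.
have mono (x y : R) : 0 <= x -> x <= y -> x `^ r <= y `^ r.
  move=> x0 xy; apply: ge0_ler_powR => //; rewrite ?nnegrE ?(ltW r0)//.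
  exact: le_trans xy.
have pointwise s : (F s * G s) `^ r <=
    \sum_a \sum_b (4 * (mu N1 a * mu N2 b)) `^ r * (lv a b s)%:R + tail.
  have /andP[F0 F1] := FN s; have /andP[G0 G1] := GN s.
  have FG0 : 0 <= F s * G s by rewrite mulr_ge0.
  have sum0 : 0 <= \sum_a \sum_b (4 * (mu N1 a * mu N2 b)) `^ r * (lv a b s)%:R.
    by apply: sumr_ge0 => a _; apply: sumr_ge0.
  have [h1|[a ha]] := dyadic_band J F1.
    apply: (@le_trans _ _ tail); last by rewrite lerDr.
    by apply: mono => //; rewrite mulrAC ler_pM.
  have [h2|[b hb]] := dyadic_band J G1.
    apply: (@le_trans _ _ tail); last by rewrite lerDr.
    by apply: mono => //; rewrite -mulrA ler_pM.
  apply: (@le_trans _ _ ((4 * (mu N1 a * mu N2 b)) `^ r * (lv a b s)%:R)).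
    rewrite /lv !mu2E ha hb mulr1; apply: mono => //.
    rewrite (_ : 4 * _ = (2 * mu N1 a) * (2 * mu N2 b)); last by ring.
    by rewrite !mu2E; case/andP: ha => _ ?; case/andP: hb => _ ?; exact: ler_pM.
  rewrite (bigD1 a)//= (bigD1 b)//= -!addrA lerDl.
  rewrite addr_ge0// ?sumr_ge0// addr_ge0// ?powR_ge0// sumr_ge0// => a' _.
  by apply: sumr_ge0.
apply: (@le_trans _ _ (\sum_s v s *
   (\sum_a \sum_b (4 * (mu N1 a * mu N2 b)) `^ r * (lv a b s)%:R + tail))).
  by apply: ler_sum => s _; rewrite ler_wpM2l.
under eq_bigr do rewrite mulrDr.
rewrite big_split/= -mulr_suml lerD2r.
under eq_bigr do rewrite mulr_sumr.
rewrite exchange_big/=.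
have -> : J%:R ^+ 2 * 4 `^ r * B = \sum_(a < J) \sum_(b < J) 4 `^ r * B.
  by rewrite !sumr_const !card_ord -mulrnA -[RHS]mulr_natl natrM expr2 !mulrA.
apply: ler_sum => a _.
under eq_bigr do rewrite mulr_sumr.
rewrite exchange_big/=; apply: ler_sum => b _.
have -> : \sum_s v s * ((4 * (mu N1 a * mu N2 b)) `^ r * (lv a b s)%:R) =
    4 `^ r * ((mu N1 a * mu N2 b) `^ r * \sum_(s | lv a b s) v s).
  rewrite [RHS]mulrA -powRM ?mulr_ge0 ?mu_ge0// mulr_sumr big_mkcond/=.
  rewrite [RHS]big_mkcond/=; apply: eq_bigr => s _.
  by case: (lv a b s); rewrite ?mulr1 ?mulr0// mulrC.
rewrite ler_wpM2l ?powR_ge0//.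
have [z1|z1] := eqVneq (mu N1 a) 0; first by rewrite z1 mul0r powR0 ?mul0r// gt_eqF.
have [z2|z2] := eqVneq (mu N2 b) 0; first by rewrite z2 mulr0 powR0 ?mul0r// gt_eqF.
by apply: lev; rewrite lt_neqAle eq_sym ?z1 ?z2 mu_ge0.
Qed.

(** The triangle inequality fails for exponents r < 1; subadditivity of the r-th
    power replaces it. *)
Lemma sum_powR_le_pieces (R : realType) (S K : finType) (v F G : S -> R)
    (Fk Gk : K -> S -> R) (r : R) :
  0 < r <= 1 -> (forall s, 0 <= v s) ->
  (forall s, 0 <= F s <= \sum_k Fk k s) -> (forall s, 0 <= G s <= \sum_k Gk k s) ->
  (forall k s, 0 <= Fk k s) -> (forall k s, 0 <= Gk k s) ->
  \sum_s v s * (F s * G s) `^ r <=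
  \sum_k \sum_l \sum_s v s * (Fk k s * Gk l s) `^ r.
Proof.
move=> r01 v0 FF GG F0 G0.
under [leRHS]eq_bigr do rewrite exchange_big/=.
rewrite exchange_big/=; apply: ler_sum => s _.
under eq_bigr do rewrite -mulr_sumr.
rewrite -mulr_sumr ler_wpM2l//.
have /andP[Fs0 Fs] := FF s; have /andP[Gs0 Gs] := GG s.
rewrite (pair_bigA _ (fun k l => (Fk k s * Gk l s) `^ r))/=.
apply: le_trans (powR_sum_le _ r01 _); last by move=> [k l]; rewrite mulr_ge0.
rewrite -(pair_bigA _ (fun k l => Fk k s * Gk l s))/=.
have -> : \sum_k \sum_l Fk k s * Gk l s = (\sum_k Fk k s) * \sum_l Gk l s.
  by rewrite mulr_suml; apply: eq_bigr => k _; rewrite mulr_sumr.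
case/andP: r01 => r0 _; apply: ge0_ler_powR; rewrite ?nnegrE ?(ltW r0) ?mulr_ge0//.
- exact: le_trans Fs.
- exact: le_trans Gs.
- exact: ler_pM.
Qed.

(** * Splitting weights by the size of their fibres *)

(** [a w] is the weight of the fibre over [w], and [A] is the power sum whose
    power 1 / s is the mixed norm up to normalisation; the exponent is
    s = (n + 2) / (n + 1) for n = m + 1. *)
Section weights.
Variables (R : realType) (W I : finType) (m : nat) (h : W * I -> R).
Hypothesis h0 : forall T, 0 <= h T.

Let s : R := m.+3%:R / m.+2%:R.
Let a w := \sum_i h (w, i).
Let A := \sum_w a w `^ s.
Let amax := \big[Num.max/0]_w a w.

Let a0 w : 0 <= a w. Proof. exact: sumr_ge0. Qed.

Let powR_s t : 0 <= t -> (t `^ s) ^+ m.+2 = t ^+ m.+3.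
Proof.
move=> t0; rewrite -powR_mulrn ?powR_ge0// -powRrM /s divfK ?pnatr_eq0//.
exact: powR_mulrn.
Qed.

Let A0 : 0 <= A. Proof. by apply: sumr_ge0 => w _; rewrite powR_ge0. Qed.

Let a_le_amax w : a w <= amax. Proof. exact: le_bigmax. Qed.

Let amax0 : 0 <= amax.
Proof. by apply: bigmax_ge_id. Qed.

Let sum_pairs (F : W * I -> R) : \sum_T F T = \sum_w \sum_i F (w, i).
Proof.
by rewrite (pair_bigA _ (fun w i => F (w, i))); apply: eq_bigr => -[].
Qed.

Lemma max_fiber_le : amax ^+ m.+3 <= A ^+ m.+2.
Proof.
rewrite -powR_s// lerXn2r ?nnegrE ?powR_ge0//.
have [[w _ ->]|->] : (exists2 w, true & amax = a w) \/ amax = 0.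
- rewrite /amax; elim/big_ind : _ => [|x y [[w _ ->]|->] [[w' _ ->]|->]|w _].
  + by right.
  + by case: (leP (a w) (a w')) => _; left; [exists w'|exists w].
  + by case: (leP (a w) 0) => _; [right|left; exists w].
  + by case: (leP 0 (a w')) => _; [left; exists w'|right].
  + by right; rewrite maxxx.
  + by left; exists w.
- by rewrite /A (bigD1 w)//= lerDl; apply: sumr_ge0 => w' _; rewrite powR_ge0.
- by rewrite powR0// mulf_neq0// ?invr_eq0 pnatr_eq0.
Qed.

Lemma weight_total : (\sum_T h T) ^+ m.+3 <= #|W|%:R ^+ m.+3 * A ^+ m.+2.
Proof.
have hW : \sum_T h T <= #|W|%:R * amax.
  rewrite sum_pairs mulr_natl -sumr_const; apply: ler_sum => w _.
  exact: a_le_amax.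
apply: (@le_trans _ _ ((#|W|%:R * amax) ^+ m.+3)).
  by rewrite lerXn2r// nnegrE ?mulr_ge0// sumr_ge0.
by rewrite exprMn ler_wpM2l ?exprn_ge0// max_fiber_le.
Qed.

Variable J : nat.
Hypothesis WJ : #|W|%:R <= 2 ^+ J :> R.

Let band (k : 'I_J.+1) w : bool :=
  (a w <= amax / 2 ^+ k) && ((k < J)%N ==> (amax / 2 ^+ k.+1 < a w)).

(** A piece whose [c] nonzero fibres all have weight between t and 2 t satisfies
    (c * 2 t)^(m+2) * 2 t = 2^(m+3) (c t^s)^(m+2), and c t^s is at most [A].
    The fibres of weight below 2^-J of the largest form the last piece: as there
    are at most 2^J fibres, their total is at most the largest weight. *)
Lemma weight_pieces : exists (hk : 'I_J.+1 -> W * I -> R) (M : 'I_J.+1 -> R),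
  [/\ forall k T, 0 <= hk k T <= h T, forall T, h T <= \sum_k hk k T,
      forall k, 0 <= M k, forall k w, \sum_i hk k (w, i) <= M k &
      forall k, (\sum_T hk k T) ^+ m.+2 * M k <= 2 ^+ m.+3 * A ^+ m.+2].
Proof.
exists (fun k T => h T * (band k T.1)%:R), (fun k => amax / 2 ^+ k).
have p0 k : 0 < 2 ^+ k :> R by rewrite exprn_gt0.
have pM k : 0 <= amax / 2 ^+ k by rewrite divr_ge0// ltW.
have fiber k w : \sum_i h (w, i) * (band k w)%:R <= (amax / 2 ^+ k) * (band k w)%:R.
  rewrite -mulr_suml; case: (boolP (band k w)) => [/andP[h1 _]|_].
    by rewrite !mulr1.
  by rewrite !mulr0.
split => [k T|[w i]|//|k w|k].
- by rewrite mulr_ge0//= ler_piMr//; case: (band _ _).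
- have [k bk] : exists k, band k w.
    have [hw|[k /andP[hk1 hk2]]] := dyadic_band J (a_le_amax w).
      by exists ord_max; rewrite /band /= ltnn hw.
    by exists (widen_ord (leqnSn J) k); rewrite /band/= hk2 hk1 ltn_ord.
  rewrite (bigD1 k)//= bk mulr1 lerDl; apply: sumr_ge0 => k' _.
  by rewrite mulr_ge0.
- apply: le_trans (fiber k w) _.
  by rewrite ler_piMr//; case: (band _ _).
set M := amax / 2 ^+ k; pose c : R := #|band k|%:R.
have c0 : 0 <= c by [].
have M0 : 0 <= M := pM k.
have N0 : 0 <= \sum_T h T * (band k T.1)%:R.
  by apply: sumr_ge0 => T _; rewrite mulr_ge0.
have NcM : \sum_T h T * (band k T.1)%:R <= c * M.
  rewrite sum_pairs/= /c mulr_natl -sumr_const [leRHS]big_mkcond/=.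
  apply: ler_sum => w _; apply: le_trans (fiber k w) _.
  rewrite [in leRHS]/in_mem/= /M; case: (band k w); rewrite ?mulr1 ?mulr0//.
have [kJ|kJ] := ltnP k J.
  pose t := amax / 2 ^+ k.+1.
  have t0 : 0 <= t by rewrite divr_ge0// ltW.
  have Mt : M = 2 * t by rewrite /M /t exprS; field; rewrite gt_eqF.
  have ct : c * t `^ s <= A.
    rewrite /c mulr_natl -sumr_const /A big_mkcond/=; apply: ler_sum => w _.
    rewrite [in leLHS]/in_mem/=; case: (boolP (band k w)) => [/andP[_]|_].
      rewrite kJ/= => /ltW tw; apply: ge0_ler_powR; rewrite ?nnegrE ?divr_ge0//.
    by rewrite powR_ge0.
  apply: (@le_trans _ _ ((c * M) ^+ m.+2 * M)).
    by rewrite ler_wpM2r// lerXn2r// nnegrE mulr_ge0.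
  have -> : (c * M) ^+ m.+2 * M = 2 ^+ m.+3 * (c * t `^ s) ^+ m.+2.
    rewrite Mt; clearbody t c.
    rewrite (exprMn _ c) (exprMn _ 2) (exprMn _ c) powR_s//.
    by rewrite (exprS t m.+2) (exprS 2 m.+2); ring.
  by rewrite ler_wpM2l ?(ltW (p0 _))// lerXn2r// nnegrE// mulr_ge0// powR_ge0.
have kE : k = J :> nat by apply/eqP; rewrite eqn_leq kJ -ltnS ltn_ord.
have Na : \sum_T h T * (band k T.1)%:R <= amax.
  apply: le_trans NcM _; rewrite /M kE mulrCA ler_piMr//.
  rewrite ler_pdivrMr// mul1r; apply: le_trans WJ.
  by rewrite /c ler_nat max_card.
have Ma : M <= amax.
  by rewrite /M ler_pdivrMr// ler_peMr// exprn_ege1// ler1n.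
apply: (@le_trans _ _ (amax ^+ m.+3)).
  rewrite [in leRHS]exprSr; apply: ler_pM => //; first by rewrite exprn_ge0.
  by rewrite lerXn2r// nnegrE.
apply: le_trans max_fiber_le _.
by rewrite ler_peMl ?exprn_ge0// exprn_ege1// ler1n.
Qed.

End weights.

Local Open Scope classical_set_scope.
Local Open Scope ring_scope.

(** * Norms, cells and volumes of tubes *)

Section enorm.
Context {R : realType}.

Lemma coord_le_enorm m (v : 'I_m -> R) j : `|v j| <= enorm v.
Proof.
rewrite -sqrtr_sqr ler_wsqrtr// (bigD1 j)//= lerDl.
by apply: sumr_ge0 => k _; rewrite sqr_ge0.
Qed.

Lemma enorm_le m (v : 'I_m -> R) r :
  (forall j, `|v j| <= r) -> enorm v <= m%:R * r.
Proof.
move=> vr; case: m v vr => [v _|m v vr].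
  by rewrite /enorm big_ord0 sqrtr0 mul0r.
have r0 : 0 <= r by apply: le_trans (vr ord0).
have mr0 : 0 <= m.+1%:R * r by rewrite mulr_ge0.
rewrite -(ger0_norm mr0) -sqrtr_sqr ler_wsqrtr//.
apply: (@le_trans _ _ (\sum_(j < m.+1) r ^+ 2)).
  apply: ler_sum => j _.
  by rewrite -real_normK ?num_real// ler_pXn2r// nnegrE.
rewrite sumr_const card_ord -[leLHS]mulr_natl exprMn ler_wpM2r ?sqr_ge0//.
by rewrite expr2 ler_peMr// ler1n.
Qed.

Lemma exists_coord_ge m (v : 'I_m -> R) : (0 < m)%N ->
  exists2 j, forall k, `|v k| <= `|v j| & enorm v <= m%:R * `|v j|.
Proof.
move=> m0; exists [arg max_(j > Ordinal m0) `|v j|]%O.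
  by case: arg_maxP => //= j _ jmax k; exact: jmax.
case: arg_maxP => //= j _ jmax; apply: enorm_le => k; exact: jmax.
Qed.

End enorm.

(** A function that depends only on which of finitely many measurable sets
    contain the point is integrated as a finite sum. *)
Section cells.
Context d {T : measurableType d} {R : realType} (mu : {measure set T -> \bar R}).

Section fibers.
Variables (S : finType) (sig : T -> S).
Hypothesis msig : forall s, measurable (sig @^-1` [set s]).

Lemma measurable_fiber_pred (P : pred S) : measurable [set x | P (sig x)].
Proof.
rewrite (_ : [set x | _] = \big[setU/set0]_(s <- enum S | P s) (sig @^-1` [set s])).
  by apply: bigsetU_measurable => s _; exact: msig.
rewrite -bigcup_seq_cond; apply/seteqP; split => x /=.
  by move=> Px; exists (sig x) => //=; rewrite mem_enum.
by move=> [s /= /andP[_ Ps] ->].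
Qed.

Lemma integral_fiber (D : set T) (h : S -> R) : measurable D ->
  (forall s, 0 <= h s) ->
  (\int[mu]_(x in D) (h (sig x))%:E =
   \sum_s (h s)%:E * mu (sig @^-1` [set s] `&` D))%E.
Proof.
move=> mD h0.
transitivity (\int[mu]_(x in D) \sum_s (h s * \1_(sig @^-1` [set s]) x)%:E)%E.
  apply: eq_integral => x _.
  rewrite sumEFin (bigD1 (sig x))//= indicE mem_set//= mulr1 big1 ?addr0// => s sx.
  rewrite indicE memNset ?mulr0//= => xs; move/eqP: sx; apply; exact: esym.
rewrite ge0_integral_sum//.
- apply: eq_bigr => s _.
  under eq_integral do rewrite EFinM.
  rewrite ge0_integralZl//=.
  + by rewrite integral_indic.
  + by apply/measurable_EFinP; apply: measurable_indic; exact: msig.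
  + by rewrite lee_fin.
- move=> s; apply/measurable_EFinP/measurable_funM => //.
- by move=> s x _; rewrite lee_fin mulr_ge0.
Qed.

Lemma sum_fiber (D : set T) (P : pred S) : measurable D -> (mu D < +oo)%E ->
  \sum_(s | P s) fine (mu (sig @^-1` [set s] `&` D)) =
  fine (mu ([set x | P (sig x)] `&` D)).
Proof.
move=> mD Doo.
have fin A : measurable A -> mu (A `&` D) \is a fin_num.
  move=> mA; rewrite ge0_fin_numE//; apply: le_lt_trans Doo.
  by apply: le_measure; rewrite ?inE//; exact: measurableI.
apply: EFin_inj; rewrite fineK; last exact/fin/measurable_fiber_pred.
rewrite -integral_indic//; last exact: measurable_fiber_pred.
rewrite -sumEFin big_mkcond/=.
transitivity (\int[mu]_(x in D) ((P (sig x))%:R : R)%:E)%E.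
  rewrite (@integral_fiber D (fun s => (P s)%:R))//; apply: eq_bigr => s _.
  by rewrite fineK ?fin//; case: (P s); rewrite ?mul1e ?mul0e.
apply: eq_integral => x _; rewrite indicE; congr (_%:R%:E)%E.
case: (boolP (P (sig x))) => Px; first by rewrite mem_set.
by rewrite memNset//; exact/negP.
Qed.

End fibers.

Definition signature (H : finType) (A : H -> set T) (x : T) : {set H} :=
  [set h | `[< A h x >]]%SET.

Lemma measurable_signature (H : finType) (A : H -> set T) :
  (forall h, measurable (A h)) ->
  forall s, measurable (signature A @^-1` [set s]).
Proof.
move=> mA s.
rewrite (_ : _ @^-1` _ =
    \big[setI/setT]_(h <- enum H) (if h \in s then A h else ~` A h)).
  by apply: bigsetI_measurable => h _; case: ifP => _ //; exact: measurableC.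
rewrite -bigcap_seq; apply/seteqP; split => x /=.
  move=> <- h _; case: ifPn; rewrite inE => /asboolP//.
move=> H1; apply/setP => h; rewrite inE; have := H1 h; rewrite /= mem_enum => /(_ isT).
by case: ifP => [_ /asboolP//|_ /asboolPn/negbTE].
Qed.

End cells.

Section volume.
Context {R : realType} (m : nat).
Local Notation RR := (measurableTypeR R).
Local Notation X := (m.-tuple RR * RR)%type.
Local Notation mu := (lebesgue_tuple m \x @lebesgue_measure R)%E.

(** Distance from a point to the axis of the tube ([w], [i]), measured in the
    horizontal hyperplane of the point; [tube] is cut out by [hdist w i x <= d]. *)
Definition hdist (w i : m.-tuple R) (x : m.-tuple R * R) : R :=
  enorm (fun j => tnth x.1 j - x.2 * tnth w j - tnth i j).

Lemma measurable_hdist w i : measurable_fun [set: X] (hdist w i).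
Proof.
apply: measurableT_comp; first exact: (continuous_measurable_fun (@sqrt_continuous R)).
apply: measurable_sum => j; apply: measurable_funX.
apply: measurable_funB; last exact: measurable_cst.
apply: measurable_funB.
  by apply: (measurableT_comp (measurable_tnth j)); exact: measurable_fst.
by apply: measurable_funM; [exact: measurable_snd|exact: measurable_cst].
Qed.

Lemma measurable_hdist_ge w i r : measurable [set x : X | r <= hdist w i x].
Proof.
have := measurable_hdist w i measurableT (measurable_itv `[r, +oo[).
by rewrite setTI; congr measurable; apply/seteqP; split => x /=;
  rewrite in_itv/= andbT.
Qed.

Lemma measurable_hdist_le w i r : measurable [set x : X | hdist w i x <= r].
Proof.
have := measurable_hdist w i measurableT (measurable_itv `]-oo, r]).
by rewrite setTI; congr measurable; apply/seteqP; split => x /=; rewrite in_itv.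
Qed.

Lemma measurable_height (a b : R) : measurable [set x : X | a <= x.2 <= b].
Proof.
have := @measurable_snd _ _ (m.-tuple RR) RR measurableT _ (measurable_itv `[a, b]).
by rewrite setTI; congr measurable; apply/seteqP; split => x /=; rewrite in_itv.
Qed.

Definition sheared_slab w i (a b r : R) : set X :=
  [set x | a <= x.2 <= b] `&` [set x | hdist w i x <= r].

Lemma measurable_sheared_slab w i a b r : measurable (sheared_slab w i a b r).
Proof.
by apply: measurableI; [exact: measurable_height|exact: measurable_hdist_le].
Qed.

(** Each horizontal section lies in a cube of side 2 r, so Fubini, integrating
    over the height last, gives the bound. *)
Lemma sheared_slab_volume w i a b r : a <= b -> 0 <= r ->
  (mu (sheared_slab w i a b r) <= ((b - a) * (2 * r) ^+ m)%:E)%E.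
Proof.
move=> ab r0.
rewrite (@product_measure_unique _ _ _ _ _ _ _
  (lebesgue_tuple m \x^ @lebesgue_measure R)%E); last 2 first.
- by move=> A B mA mB; exact: product_measure2E.
- exact: measurable_sheared_slab.
rewrite /product_measure2; set S := sheared_slab w i a b r.
have mS : measurable S := measurable_sheared_slab w i a b r.
apply: (@le_trans _ _ (\int[lebesgue_measure]_(y in `[a, b])
    lebesgue_tuple m (ysection S y))%E).
  rewrite [leRHS]integral_mkcond le_eqVlt; apply/orP; left; apply/eqP.
  apply: eq_integral => y _; rewrite patchE; case: ifPn => // yab.
  rewrite /= (_ : ysection S y = set0) ?measure0//.
  apply/seteqP; split => // x /ysectionP[/= hy _]; move/negP: yab; apply.
  by rewrite inE/= in_itv.
apply: (@le_trans _ _ (\int[lebesgue_measure]_(x in `[a, b])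
    cst ((2 * r) ^+ m)%:E x)%E); last first.
  rewrite integral_cst//= lebesgue_measure_itv/= lte_fin; case: ifPn => _.
    by rewrite -EFinB -EFinM mulrC.
  by rewrite mule0 lee_fin mulr_ge0// ?subr_ge0// exprn_ge0// mulr_ge0.
apply: ge0_le_integral => //.
  exact/measurable_funTS/measurable_fun_ysection.
move=> y _ /=.
pose c (j : 'I_m) := y * tnth w j + tnth i j.
pose A (j : 'I_m) : set RR := `[c j - r, c j + r]%classic.
apply: (@le_trans _ _ (lebesgue_tuple m [set t | forall j, A j (tnth t j)])).
  apply: le_measure; rewrite ?inE.
  - exact: measurable_ysection.
  - rewrite (_ : [set _ | _] = \big[setI/setT]_(j < m)
      ((fun t : m.-tuple RR => tnth t j) @^-1` A j)).
      apply: bigsetI_measurable => j _; rewrite -[X in measurable X]setTI.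
      by apply: measurable_tnth => //; exact: measurable_itv.
    rewrite -bigcap_seq; apply/seteqP; split => t /= H; first by move=> j _; exact: H.
    by move=> j; apply: (H j); rewrite /= mem_index_enum.
  - move=> t /ysectionP[_ /= ht] j; have := le_trans (coord_le_enorm _ j) ht.
    by rewrite /A/= in_itv/= ler_norml /c; lra.
rewrite lebesgue_tuple_box => [|j]; last exact: measurable_itv.
rewrite (eq_bigr (fun=> (2 * r)%:E)) => [|j _].
  by rewrite prodEFin prodr_const card_ord.
rewrite lebesgue_measure_itv/= lte_fin; case: ifPn => h.
  by rewrite -EFinB; congr EFin; ring.
by move: h; rewrite -leNgt => h; congr EFin; lra.
Qed.

Definition vol (A : set X) : R := fine (mu A).

Lemma vol_ge0 A : 0 <= vol A. Proof. by rewrite fine_ge0. Qed.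

Lemma sheared_slab_fin w i a b r A : measurable A ->
  A `<=` sheared_slab w i a b r -> (mu A < +oo)%E.
Proof.
move=> mA AS.
have [ab|ba] := leP a b; last first.
  rewrite (_ : A = set0) ?measure0// -subset0 => x /AS[/= /andP[h1 h2] _].
  by move: (le_trans h1 h2); rewrite leNgt ba.
have [r0|r0] := leP 0 r; last first.
  rewrite (_ : A = set0) ?measure0// -subset0 => x /AS[/= _ h].
  by move: (le_lt_trans h r0); rewrite ltNge sqrtr_ge0.
apply: (@le_lt_trans _ _ (mu (sheared_slab w i a b r))).
  by apply: le_measure; rewrite ?inE//; exact: measurable_sheared_slab.
by apply: le_lt_trans (sheared_slab_volume w i ab r0) _; rewrite ltry.
Qed.

Lemma vol_le w i a b r A : measurable A -> a <= b -> 0 <= r ->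
  A `<=` sheared_slab w i a b r -> vol A <= (b - a) * (2 * r) ^+ m.
Proof.
move=> mA ab r0 AS; rewrite -lee_fin fineK; last first.
  by rewrite ge0_fin_numE// (sheared_slab_fin mA AS).
apply: le_trans (sheared_slab_volume w i ab r0).
by apply: le_measure; rewrite ?inE//; exact: measurable_sheared_slab.
Qed.

Lemma tubeE (d : R) w i : tube d w i = sheared_slab w i (-1) 1 d.
Proof. by apply/seteqP; split => x /=; rewrite /tube/= ler_norml. Qed.

Lemma tube_coord (d : R) (w i : m.-tuple R) (x : X) (j : 'I_m) : tube d w i x ->
  `|tnth x.1 j - x.2 * tnth w j - tnth i j| <= d.
Proof. by move=> [_]; apply: le_trans (coord_le_enorm _ j). Qed.

Lemma vol_tube_part (d : R) w i A t0 r : measurable A -> 0 <= d -> 0 <= r ->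
  A `<=` tube d w i -> (forall x, A x -> `|x.2 - t0| <= r) ->
  vol A <= 2 * r * (2 * d) ^+ m.
Proof.
move=> mA d0 r0 AT At.
apply: le_trans (vol_le (w := w) (i := i) (a := t0 - r) (b := t0 + r) mA _ d0 _) _.
- lra.
- move=> x Ax; split => /=; last by case: (AT _ Ax).
  by have := At _ Ax; rewrite ler_distl.
- by rewrite (_ : t0 + r - _ = 2 * r)//; ring.
Qed.

Lemma vol_tube (d : R) w i A : measurable A -> 0 <= d ->
  A `<=` tube d w i -> vol A <= 2 * (2 * d) ^+ m.
Proof.
move=> mA d0 AT; have := @vol_tube_part d w i A 0 1 mA d0 ler01 AT.
by rewrite mulr1; apply => x /AT[]; rewrite subr0.
Qed.

(** At a common point the [j]-th coordinates of the two axes differ by at most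
    2 d, which confines the height to an interval of length 4 d / |D|; for nearly
    parallel tubes, with |D| <= d, the volume of one tube is small enough. *)
Lemma vol_tube_cross (d : R) w i w' i' A j : measurable A -> 0 < d ->
  A `<=` tube d w i -> A `<=` tube d w' i' ->
  vol A <= 8 * (2 * d) ^+ m * (d / (d + `|tnth w j - tnth w' j|)).
Proof.
move=> mA d0 AT AT'; set D := tnth w j - tnth w' j.
have p0 : 0 <= (2 * d) ^+ m by rewrite exprn_ge0// mulr_ge0// ltW.
have dD : 0 < d + `|D| by rewrite ltr_wpDr.
rewrite (_ : _ * _ * _ = 8 * (d / (d + `|D|)) * (2 * d) ^+ m); last by ring.
have [Dd|Dd] := leP `|D| d.
  apply: le_trans (vol_tube mA (ltW d0) AT) _.
  rewrite ler_wpM2r// mulrA ler_pdivlMr//; lra.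
have D0 : 0 < `|D| := lt_trans d0 Dd.
have := @vol_tube_part d w i A (- (tnth i j - tnth i' j) / D) (2 * d / `|D|) mA (ltW d0).
rewrite divr_ge0 ?mulr_ge0 ?(ltW d0)// => /(_ isT AT) h.
apply: le_trans (h _) _.
  move=> x Ax; rewrite -(ler_pM2r D0) -normrM divfK ?gt_eqF//.
  rewrite mulrBl divfK -?normr_gt0//.
  have := tube_coord j (AT _ Ax); have := tube_coord j (AT' _ Ax).
  by rewrite /D !ler_norml; lra.
rewrite ler_wpM2r// !mulrA ler_pdivlMr// mulrAC ler_pdivrMr//; nra.
Qed.

End volume.

(** * Geometry of the tubes that meet a fixed tube *)

Section geometry.
Context {R : realType} (m : nat).
Local Notation RR := (measurableTypeR R).
Local Notation X := (m.-tuple RR * RR)%type.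

(** Both axes pass within [d] of [x0], and they separate at speed at least
    [kappa] in coordinate [j]; so a point of the second tube near the axis of the
    first has nearly the height of [x0]. *)
Lemma vol_near (d rho kappa : R) (w1 i1 w2 i2 : m.-tuple R) (x0 : X) A j :
  measurable A -> 0 <= d -> 0 <= rho -> 0 < kappa ->
  kappa <= `|tnth w2 j - tnth w1 j| ->
  tube d w1 i1 x0 -> tube d w2 i2 x0 ->
  A `<=` tube d w2 i2 -> (forall x, A x -> hdist w1 i1 x <= rho) ->
  vol A <= 2 * ((rho + 3 * d) / kappa) * (2 * d) ^+ m.
Proof.
move=> mA d0 rho0 k0 kj T1x T2x AT Arho.
have r0 : 0 <= (rho + 3 * d) / kappa by rewrite divr_ge0 ?(ltW k0)//; lra.
apply: (vol_tube_part (t0 := x0.2) mA d0 r0 AT) => x Ax.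
rewrite ler_pdivlMr//; apply: (@le_trans _ _ (`|x.2 - x0.2| * `|tnth w2 j - tnth w1 j|)).
  by rewrite ler_wpM2l.
have h1 := le_trans (coord_le_enorm _ j) (Arho _ Ax).
have h2 := tube_coord j (AT _ Ax).
have h3 := tube_coord j T1x; have h4 := tube_coord j T2x.
by move: h1 h2 h3 h4; rewrite -normrM !ler_norml; lra.
Qed.

(** Place the origin on the axis of the first tube and let u, u' be the relative
    directions of the other two.  The vector [Y] from that axis to [x23] is within
    3 d of a u and of a' u', where [a] and [a'] are the heights of [x23] above the
    two crossings.  As [Y] has length at least rho, |a'| is at least a
    multiple of rho; hence u' is within O(d / rho) of a multiple of u, and [j],
    the largest coordinate of u, parametrises the line through u. *)
Lemma direction_in_slab (d rho : R) (w1 i1 w2 i2 w3 i3 : m.-tuple R) j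
    (x12 x13 x23 : X) :
  0 < d -> 6 * m%:R * d <= rho ->
  cube w1 -> cube w3 ->
  (forall k, `|tnth w2 k - tnth w1 k| <= `|tnth w2 j - tnth w1 j|) ->
  0 < `|tnth w2 j - tnth w1 j| ->
  tube d w1 i1 x12 -> tube d w2 i2 x12 ->
  tube d w1 i1 x13 -> tube d w3 i3 x13 ->
  tube d w2 i2 x23 -> tube d w3 i3 x23 -> rho <= hdist w1 i1 x23 ->
  forall k, `|tnth w3 k - tnth w2 k - (tnth w2 k - tnth w1 k)
    / (tnth w2 j - tnth w1 j) * (tnth w3 j - tnth w2 j)| <= 48 * m%:R * d / rho.
Proof.
move=> d0 drho c1 c3 jmax uj0 t1 t2 t3 t4 t5 t6 far k.
have m0 : 0 < m%:R :> R by rewrite ltr0n (leq_ltn_trans _ (ltn_ord j)).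
have rho0 : 0 < rho by apply: lt_le_trans drho; rewrite !mulr_gt0.
pose Y k := tnth x23.1 k - x23.2 * tnth w1 k - tnth i1 k.
pose u k := tnth w2 k - tnth w1 k; pose u' k := tnth w3 k - tnth w1 k.
pose a := x23.2 - x12.2; pose a' := x23.2 - x13.2.
have Yu l : `|Y l - a * u l| <= 3 * d.
  have := tube_coord l t1; have := tube_coord l t2; have := tube_coord l t5.
  by rewrite /Y /a /u !ler_norml; lra.
have Yu' l : `|Y l - a' * u' l| <= 3 * d.
  have := tube_coord l t3; have := tube_coord l t4; have := tube_coord l t6.
  by rewrite /Y /a' /u' !ler_norml; lra.
have a'big : rho / (4 * m%:R) <= `|a'|.
  have [|l _ Yl] := @exists_coord_ge R m Y; first by rewrite -(ltr0n R).
  have Ylrho : rho / m%:R <= `|Y l|.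
    by rewrite ler_pdivrMr// mulrC (le_trans far Yl).
  have : `|Y l| <= 3 * d + `|a'| * `|u' l|.
    by rewrite -normrM; have := Yu' l; have := ler_distD (a' * u' l) (Y l) 0;
      rewrite !subr0; lra.
  have : `|u' l| <= 2.
    by have := c1 l; have := c3 l; rewrite /u' !ler_norml; lra.
  move=> /(ler_wpM2l (normr_ge0 a')).
  have : 6 * d <= rho / m%:R by rewrite ler_pdivlMr//; lra.
  rewrite (_ : rho / (4 * m%:R) = rho / m%:R / 4); last by field; rewrite gt_eqF.
  by move: Ylrho; lra.
have a'0 : 0 < `|a'| by apply: lt_le_trans a'big; rewrite divr_gt0// mulr_gt0.
have uj : u j != 0 by rewrite -normr_gt0.
rewrite -/(u k) -/(u j).
have -> : tnth w3 k - tnth w2 k - u k / u j * (tnth w3 j - tnth w2 j) =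
    u' k - u k / u j * u' j.
  by rewrite /u'; rewrite /u in uj *; field.
have e l : `|a' * u' l - a * u l| <= 6 * d.
  by have := Yu l; have := Yu' l; rewrite !ler_norml; lra.
have E : a' * (u' k - u k / u j * u' j) =
    (a' * u' k - a * u k) - u k / u j * (a' * u' j - a * u j) by field.
have : `|a'| * `|u' k - u k / u j * u' j| <= 12 * d.
  rewrite -normrM E (le_trans (ler_normB _ _))//.
  rewrite (_ : 12 * d = 6 * d + 1 * (6 * d)); last by ring.
  rewrite lerD// normrM ler_pM//.
  by rewrite normrM normfV ler_pdivrMr ?normr_gt0// mul1r jmax.
move=> h; rewrite ler_pdivlMr// mulrC.
have : rho / (4 * m%:R) * `|u' k - u k / u j * u' j| <= 12 * d.
  by apply: le_trans h; rewrite ler_wpM2r.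
rewrite mulrAC ler_pdivrMr ?mulr_gt0//; lra.
Qed.

End geometry.

(** * The level set estimate *)

Section level_sets.
Context {R : realType} (m : nat).
Local Notation RR := (measurableTypeR R).
Local Notation X := (m.-tuple RR * RR)%type.
Hypothesis m0 : (0 < m)%N.
Variables (d kappa : R) (L : nat) (E : {fset m.-tuple R}).
Hypothesis d0 : 0 < d.
Hypothesis d1 : d <= 1.
Hypothesis dL : 1 <= d * 2 ^+ L.
Hypothesis Ecube : forall w : E, cube (val w).
Hypothesis Esep : Defs.separated d [set` E].
Hypothesis kappa0 : 0 < kappa.
Hypothesis kappa1 : kappa <= 1.

Implicit Types (T U : E * E).
Local Notation tb T := (tube d (val T.1) (val T.2)).
Local Notation dir T := (tnth (val T.1)).

(** A set of bounded volume that contains all the tubes. *)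
Definition support_box : set X :=
  sheared_slab [tuple of nseq m 0] [tuple of nseq m 0] (-1) 1 (3 * m%:R).

Lemma measurable_tube (w i : m.-tuple R) : measurable (tube d w i : set X).
Proof. by rewrite tubeE; exact: measurable_sheared_slab. Qed.

Lemma tube_sub_box T : tb T `<=` support_box.
Proof.
move=> x Tx; have [hx _] := Tx; split => /=; first by rewrite -ler_norml.
rewrite [3 * _]mulrC; apply: enorm_le => j.
rewrite !tnth_nseq mulr0 !subr0.
have := tube_coord j Tx; have := Ecube T.1 j; have := Ecube T.2 j => /= h1 h2 h3.
have h4 : `|x.2 * tnth (val T.1) j| <= 1.
  by rewrite normrM mulr_ile1.
by move: h1 h3 h4 d1; rewrite !ler_norml; lra.
Qed.

Variables (f g : E * E -> R) (M mu1 mu2 : R).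
Hypothesis f0 : forall T, 0 <= f T.
Hypothesis g0 : forall U, 0 <= g U.
Hypothesis mu10 : 0 < mu1.
Hypothesis mu20 : 0 < mu2.
Hypothesis M0 : 0 <= M.
Hypothesis gM : forall w, \sum_i g (w, i) <= M.
Hypothesis transverse : forall T U, 0 < f T -> 0 < g U ->
  exists2 j, kappa <= `|dir U j - dir T j| &
    forall k, `|dir U k - dir T k| <= `|dir U j - dir T j|.

Definition level_set : set X :=
  [set x | mu1 < Xstar d f x <= 2 * mu1 /\ mu2 < Xstar d g x <= 2 * mu2].

Local Notation N1 := (\sum_T f T).
Local Notation N2 := (\sum_U g U).
Local Notation V := (vol (level_set : set X)).

Lemma XstarE (h : E * E -> R) x :
  Xstar d h x = \sum_T h T * \1_(tb T) x.
Proof.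
by rewrite /Xstar (pair_bigA _ (fun w i => h (w, i) * \1_(tube d (val w) (val i)) x));
  apply: eq_bigr => -[].
Qed.

Section cells.
Variable rho : R.

(** The sets that define the cells: the tubes, with tag [false], and the regions
    at distance at least [rho] from their axes, with tag [true]. *)
Definition cell_family (h : bool * (E * E)) : set X :=
  if h.1 then [set x | rho <= hdist (val h.2.1) (val h.2.2) x] else tb h.2.

Lemma measurable_cell_family h : measurable (cell_family h).
Proof.
by rewrite /cell_family; case: ifP => _;
  [exact: measurable_hdist_ge|exact: measurable_tube].
Qed.

Let sig : X -> {set bool * (E * E)} := signature cell_family.

Let msig s : measurable (sig @^-1` [set s]).
Proof. by apply: measurable_signature => h; exact: measurable_cell_family. Qed.

Definition cell_vol s : R := vol (sig @^-1` [set s] `&` support_box).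

Definition cell_tube T (s : {set bool * (E * E)}) := (false, T) \in s.
Definition cell_far T (s : {set bool * (E * E)}) := (true, T) \in s.

Lemma cell_tubeE T x : cell_tube T (sig x) = `[< tb T x >].
Proof. by rewrite /cell_tube inE. Qed.

Lemma cell_farE T x :
  cell_far T (sig x) = `[< rho <= hdist (val T.1) (val T.2) x >].
Proof. by rewrite /cell_far inE. Qed.

Lemma sum_cell_vol (P : pred {set bool * (E * E)}) : \sum_(s | P s) cell_vol s =
  vol ([set x | P (sig x)] `&` support_box).
Proof.
rewrite /cell_vol /vol sum_fiber//.
- exact: measurable_sheared_slab.
- have mB := @measurable_sheared_slab R m.
  exact: (sheared_slab_fin (mB _ _ _ _ _) (@subset_refl _ _)).
Qed.

Lemma measurable_cells (P : pred {set bool * (E * E)}) :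
  measurable ([set x | P (sig x)] `&` support_box).
Proof.
apply: measurableI; first exact: (measurable_fiber_pred msig).
exact: measurable_sheared_slab.
Qed.

Lemma Xstar_sig (h : E * E -> R) x :
  Xstar d h x = \sum_T h T * (cell_tube T (sig x))%:R.
Proof.
rewrite XstarE; apply: eq_bigr => T _; rewrite cell_tubeE indicE.
by congr (_ * _%:R).
Qed.

Let F s : R := \sum_T f T * (cell_tube T s)%:R.
Let G s : R := \sum_T g T * (cell_tube T s)%:R.

Definition level_cell s := (mu1 < F s <= 2 * mu1) && (mu2 < G s <= 2 * mu2).

Lemma sum_level_cells : \sum_(s | level_cell s) cell_vol s = V.
Proof.
rewrite sum_cell_vol; congr vol; apply/seteqP; split => x.
  by move=> [/andP[]]; rewrite /F /G -!Xstar_sig.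
move=> [Fx Gx]; split; first by rewrite /= /level_cell /F /G -!Xstar_sig Fx.
apply: contrapT => nx; move: Fx; rewrite (Xstar_sig f) big1 ?ltNge ?(ltW mu10)// => T _.
rewrite cell_tubeE; case: asboolP => [/tube_sub_box//|_]; by rewrite mulr0.
Qed.

Definition meets T U := `[< exists x, tb T x /\ tb U x >].

Lemma cross_cells T U : 0 < f T -> 0 < g U ->
  \sum_(s | cell_tube T s && cell_tube U s) cell_vol s <=
  8 * (2 * d) ^+ m * (d / kappa) * (meets T U)%:R.
Proof.
move=> fT gU; rewrite sum_cell_vol /meets; case: asboolP => TU; last first.
  rewrite (_ : _ `&` _ = set0); first by rewrite /vol measure0 mulr0.
  rewrite -subset0 => x [/= /andP[]]; rewrite !cell_tubeE => /asboolP xT /asboolP xU _.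
  by apply: TU; exists x.
have [j kj _] := transverse fT gU.
rewrite mulr1.
apply: (@le_trans _ _ (8 * (2 * d) ^+ m * (d / (d + `|dir U j - dir T j|)))).
  apply: (@vol_tube_cross _ _ d (val U.1) (val U.2) (val T.1)
    (val T.2) _ j (measurable_cells (fun s => cell_tube T s && cell_tube U s)) d0).
- by move=> x [/= /andP[_]]; rewrite cell_tubeE => /asboolP.
- by move=> x [/= /andP[+ _]]; rewrite cell_tubeE => /asboolP.
rewrite ler_wpM2l ?mulr_ge0 ?exprn_ge0 ?mulr_ge0 ?(ltW d0)// ler_wpM2l ?(ltW d0)//.
rewrite lef_pV2 ?posrE// ?ltr_wpDr//; move: d0 kj; lra.
Qed.

Lemma near_cells T U : 0 <= rho -> 0 < f T -> 0 < g U -> meets T U ->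
  \sum_(s | cell_tube U s && ~~ cell_far T s) cell_vol s <=
  2 * ((rho + 3 * d) / kappa) * (2 * d) ^+ m.
Proof.
move=> rho0 fT gU /asboolP[x0 [Tx0 Ux0]]; rewrite sum_cell_vol.
have [j kj _] := transverse fT gU.
apply: (vol_near (measurable_cells (fun s => cell_tube U s && ~~ cell_far T s))
  (ltW d0) rho0 kappa0 kj Tx0 Ux0).
  by move=> x [/= /andP[+ _]]; rewrite cell_tubeE => /asboolP.
move=> x [/= /andP[_ +] _]; rewrite cell_farE => /asboolPn/negP.
by rewrite -ltNge => /ltW.
Qed.

(** The bound of [slab_sum] for a slab of half-width A = 48 m d / rho, the width
    given by [direction_in_slab]. *)
Definition slab_bound : R :=
  4 * m%:R * (L + 8 * m + 3)%:R * (4 * m%:R * (48 * m%:R * d / rho) / d + 4) ^+ m.-1.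

(** For a fixed [U] in the brush of [T], a tube [U'] that meets it far from [T]
    has its direction in a slab through the direction of [U], and meets [U] in
    volume O(d^m * d / (d + distance of the directions)).  The tubes of one
    direction weigh at most [M], so only directions are counted. *)
Lemma overlap_cells T U : 6 * m%:R * d <= rho -> 0 < f T -> 0 < g U -> meets T U ->
  \sum_(U' | meets T U') g U' *
     \sum_(s | [&& cell_tube U s, cell_tube U' s & cell_far T s]) cell_vol s
  <= M * (8 * (2 * d) ^+ m * slab_bound).
Proof.
move=> drho fT gU /asboolP[x12 [Tx12 Ux12]].
have [j kj jmax] := transverse fT gU.
have uj0 := lt_le_trans kappa0 kj.
have rho0 : 0 < rho.
  by apply: lt_le_trans drho; rewrite mulr_gt0// mulr_gt0// ltr0n.
pose A := 48 * m%:R * d / rho.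
have A0 : 0 <= A by rewrite divr_ge0 ?mulr_ge0 ?(ltW d0) ?(ltW rho0).
(* Slopes of the line through the direction of [U] over coordinate [j]. *)
pose s k := if k == j then 0 else (dir U k - dir T k) / (dir U j - dir T j).
pose P (w : E) := [forall k, (k != j) ==>
  (`|tnth (val w) k - dir U k - s k * (tnth (val w) j - dir U j)| <= A)].
pose q (w : E) := d / (d + `|tnth (val w) j - dir U j|).
have p0 : 0 <= 8 * (2 * d) ^+ m by rewrite mulr_ge0// exprn_ge0// mulr_ge0// ltW.
have q0 w : 0 <= q w by rewrite divr_ge0 ?addr_ge0// ltW.
have inner U' : meets T U' ->
    \sum_(s | [&& cell_tube U s, cell_tube U' s & cell_far T s]) cell_vol s <=
    8 * (2 * d) ^+ m * (q U'.1 * (P U'.1)%:R).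
  move=> /asboolP[x13 [Tx13 Ux13]]; rewrite sum_cell_vol.
  (* Outside the slab the far intersection is empty. *)
  have [PU'|PU'] := boolP (P U'.1).
    rewrite mulr1; apply: (@vol_tube_cross _ _ d (val U'.1) (val U'.2) (val U.1)
      (val U.2) _ j (measurable_cells
        (fun s => [&& cell_tube U s, cell_tube U' s & cell_far T s])) d0).
    - by move=> x [/= /and3P[_ + _]]; rewrite cell_tubeE => /asboolP.
    - by move=> x [/= /and3P[+ _ _]]; rewrite cell_tubeE => /asboolP.
  rewrite !mulr0 (_ : _ `&` _ = set0); first by rewrite /vol measure0.
  rewrite -subset0 => x [/= /and3P[]].
  rewrite !cell_tubeE cell_farE => /asboolP xU /asboolP xU' /asboolP xT _.
  move/negP: PU'; apply; apply/forallP => k; apply/implyP => kj'.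
  rewrite /s (negbTE kj').
  by apply: (direction_in_slab d0 drho (Ecube T.1) (Ecube U'.1) jmax uj0
    Tx12 Ux12 Tx13 Ux13 xU xU' xT).
apply: (@le_trans _ _ (\sum_U' g U' * (8 * (2 * d) ^+ m * (q U'.1 * (P U'.1)%:R)))).
  rewrite big_mkcond/=; apply: ler_sum => U' _; case: ifPn => [mU'|_].
    by rewrite ler_wpM2l// inner.
  by apply: mulr_ge0 => //; apply: mulr_ge0 => //; apply: mulr_ge0.
apply: (@le_trans _ _ (M * (8 * (2 * d) ^+ m * \sum_(w | P w) q w))).
  rewrite [X in M * (_ * X)]big_mkcond/= !mulr_sumr.
  rewrite (_ : \sum_U' _ =
    \sum_w \sum_i g (w, i) * (8 * (2 * d) ^+ m * (q w * (P w)%:R))); last first.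
    rewrite (pair_bigA _
      (fun w i => g (w, i) * (8 * (2 * d) ^+ m * (q w * (P w)%:R)))).
    by apply: eq_bigr => -[].
  apply: ler_sum => w _; rewrite -mulr_suml.
  rewrite (_ : q w * _ = if P w then q w else 0).
    by rewrite ler_wpM2r// mulr_ge0//; case: ifP.
  by case: ifP; rewrite ?mulr1 ?mulr0.
rewrite ler_wpM2l// ler_wpM2l//.
apply: (@slab_sum R m _ (fun (x : E) k => tnth (val x) k) d L d0 dL _ _
  A P j s (dir U)).
- by move=> x k; exact: Ecube.
- move=> x y xy; have := Esep (valP x) (valP y); rewrite /edist /enorm; apply.
  by apply: contra xy => /eqP/val_inj ->.
- exact: A0.
- by rewrite /s eqxx.
- move=> k; rewrite /s; case: ifP => _; first by rewrite normr0.
  by rewrite normrM normfV ler_pdivrMr// mul1r.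
- by move=> k; exact: (Ecube U.1).
- by move=> x k /forallP/(_ k)/implyP.
Qed.

Lemma level_set_mass : mu2 * V <= \sum_U g U * (2 * (2 * d) ^+ m).
Proof.
rewrite -sum_level_cells mulr_sumr.
have v0 s : 0 <= cell_vol s by rewrite vol_ge0.
apply: (@le_trans _ _ (\sum_(s | level_cell s) cell_vol s * G s)).
  apply: ler_sum => s /andP[_ /andP[/ltW Gs _]].
  by rewrite mulrC ler_wpM2l.
under eq_bigr do rewrite mulr_sumr.
rewrite exchange_big/=; apply: ler_sum => U _.
under eq_bigr do rewrite mulrCA.
rewrite -mulr_sumr ler_wpM2l//.
apply: (@le_trans _ _ (\sum_(s | cell_tube U s) cell_vol s)).
  rewrite big_mkcond/= [leRHS]big_mkcond/=; apply: ler_sum => s _.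
  by case: (level_cell s); case: (cell_tube U s); rewrite ?mulr1 ?mulr0.
rewrite sum_cell_vol; apply: (vol_tube (w := val U.1) (i := val U.2)
  (measurable_cells (cell_tube U)) (ltW d0)).
by move=> x [/= + _]; rewrite cell_tubeE => /asboolP.
Qed.

End cells.

Lemma Xstar_le_sum (h : E * E -> R) x : (forall T, 0 <= h T) ->
  Xstar d h x <= \sum_T h T.
Proof.
move=> h0; rewrite XstarE; apply: ler_sum => T _.
by rewrite indicE; case: (_ \in _); rewrite ?mulr1 ?mulr0.
Qed.

(** The constants of the cases in which l = lam / d^m is below, respectively
    above, a multiple of d. *)
Definition narrow_const : R :=
  (22 * m%:R) ^+ m * (6 * m%:R * 2 ^+ (m + 5) / kappa) ^+ m.+1.

Definition wide_const : R :=
  128 * (8 * 2 ^+ m / kappa) * (8 * 2 ^+ m * (4 * m%:R * (8 * m + 3)%:R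
    * (196 * m%:R ^+ 2 * 2 ^+ (m + 5) / kappa) ^+ m.-1)).

(** When l is O(d), the trivial bound of G by the total weight of all directions
    is sharp enough: the loss d^(-m) is compensated by l^(m+1). *)
Lemma level_set_narrow (l : R) : 0 <= l -> level_set !=set0 ->
  l * kappa / 2 ^+ (m + 5) <= 6 * m%:R * d ->
  mu1 * mu2 * l ^+ m.+1 <=
  narrow_const * d * N1 * M.
Proof.
rewrite /narrow_const.
move=> l0 [x [/andP[Fx _] /andP[Gx _]]] lsmall.
have mu1N : mu1 <= N1 := ltW (lt_le_trans Fx (Xstar_le_sum x f0)).
have mu2M : mu2 <= (22 * m%:R / d) ^+ m * M.
  apply: (@le_trans _ _ N2); first exact: ltW (lt_le_trans Gx (Xstar_le_sum x g0)).
  rewrite (_ : N2 = \sum_w \sum_i g (w, i)); last first.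
    rewrite (pair_bigA _ (fun w i => g (w, i))).
    by apply: eq_bigr => -[].
  apply: (@le_trans _ _ (\sum_(w : E) M)); first exact: ler_sum.
  rewrite sumr_const -[leLHS]mulr_natl ler_wpM2r//.
  apply: (@separated_card_le R m _ (fun (x : E) k => tnth (val x) k)) => //.
  move=> y z yz; have := Esep (valP y) (valP z); rewrite /edist /enorm; apply.
  by apply: contra yz => /eqP/val_inj ->.
pose A := 6 * m%:R * 2 ^+ (m + 5) / kappa.
have lA : l <= A * d.
  have t0 : 0 < 2 ^+ (m + 5) :> R by rewrite exprn_gt0.
  rewrite /A mulrAC ler_pdivlMr//; move: lsmall; rewrite ler_pdivrMr//; lra.
have A0 : 0 <= A by rewrite divr_ge0 ?(ltW kappa0)// mulr_ge0// ?exprn_ge0// mulr_ge0.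
rewrite -/A; have -> : (22 * m%:R) ^+ m * A ^+ m.+1 * d * N1 * M =
    N1 * ((22 * m%:R / d) ^+ m * M) * (A * d) ^+ m.+1.
  have -> : (22 * m%:R / d) ^+ m = (22 * m%:R) ^+ m / d ^+ m.
    by rewrite exprMn exprVn.
  have -> : (A * d) ^+ m.+1 = A ^+ m.+1 * (d * d ^+ m) by rewrite exprMn (exprS d).
  set Am := A ^+ _; set D := d ^+ m; set B := (_ ^+ m).
  have D0 : D != 0 by rewrite expf_neq0 ?gt_eqF.
  by clearbody Am D B; field.
apply: ler_pM => //; first by rewrite mulr_ge0// ltW.
- by rewrite exprn_ge0.
- by apply: ler_pM => //; exact: ltW.
- by rewrite lerXn2r// nnegrE// mulr_ge0// ltW.
Qed.

(** The radius [rho] is chosen so that [vol_near] leaves volume at most lam / 8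
    near [T]; it is at least 6 m d by hypothesis, and at most 1 because l is at
    most 2^(m+1), the volume of a tube being at most 2 (2 d)^m. *)
Lemma level_set_wide (l : R) : 0 < V -> l * d ^+ m * N2 = mu2 * V ->
  6 * m%:R * d <= l * kappa / 2 ^+ (m + 5) ->
  mu1 * mu2 * l ^+ m.+1 <=
  wide_const * L.+1%:R * d * N1 * M.
Proof.
rewrite /wide_const.
move=> V0 lE; set rho := l * kappa / 2 ^+ (m + 5) => drho.
have mR : 0 < m%:R :> R by rewrite ltr0n.
have t0 : 0 < 2 ^+ (m + 5) :> R by rewrite exprn_gt0.
have rho0 : 0 < rho by apply: lt_le_trans drho; rewrite !mulr_gt0.
have dm0 : 0 < d ^+ m by rewrite exprn_gt0.
have l0 : 0 < l.
  move: rho0; rewrite /rho pmulr_lgt0 ?invr_gt0// pmulr_lgt0//.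
have [x lx] : level_set !=set0.
  apply/set0P/eqP => e; move: V0; rewrite e /vol measure0/= ltxx//.
have N20 : 0 < N2.
  by case: lx => _ /andP[Gx _]; apply: lt_trans mu20 (lt_le_trans Gx (Xstar_le_sum x g0)).
have N10 : 0 <= N1 by apply: sumr_ge0.
have l2 : l <= 2 * 2 ^+ m.
  have := level_set_mass rho; rewrite -lE -mulr_suml mulrC ler_pM2l//.
  by rewrite exprMn mulrA ler_pM2r.
have rho1 : rho <= 1.
  rewrite /rho ler_pdivrMr// mul1r exprD (_ : 2 ^+ 5 = 32); last by ring.
  have p0 : 0 < 2 ^+ m :> R by rewrite exprn_gt0.
  have : l * kappa <= l by rewrite ler_piMr// ltW.
  lra.
pose lam := l * d ^+ m.
have p0 : 0 <= 8 * (2 * d) ^+ m by rewrite mulr_ge0// exprn_ge0// mulr_ge0// ltW.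
have A0 : 0 <= 4 * m%:R * (48 * m%:R * d / rho) / d + 4.
  have h : 0 <= 48 * m%:R * d / rho.
    by apply: divr_ge0; rewrite ?(ltW rho0)// mulr_ge0 ?(ltW d0)// mulr_ge0.
  by apply: addr_ge0 => //; apply: divr_ge0; rewrite ?(ltW d0)// mulr_ge0// mulr_ge0.
have slab0 : 0 <= slab_bound rho.
  by apply: mulr_ge0; rewrite ?exprn_ge0// mulr_ge0// mulr_ge0.
have key : mu1 * mu2 * lam ^+ 2 <= 128 * (8 * (2 * d) ^+ m * (d / kappa)) *
    (M * (8 * (2 * d) ^+ m * slab_bound rho)) * N1.
  apply: (@hairbrush R _ _ (cell_vol rho) (fun T => cell_tube T) level_cell
    (fun T => cell_far T) meets f g) => //.
  - by move=> s; exact: vol_ge0.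
  - by rewrite mulr_ge0 ?(ltW l0)// ltW.
  - by rewrite sum_level_cells.
  - by apply: mulr_ge0 => //; apply: mulr_ge0.
  - by apply: mulr_ge0 => //; rewrite divr_ge0// ltW.
  - by move=> s /andP[/andP[/ltW -> ->]].
  - by move=> s /andP[_ /andP[/ltW ->]].
  - by rewrite sum_level_cells /lam lE.
  - exact: cross_cells.
  - move=> T U fT gU mTU; apply: le_trans (near_cells (ltW rho0) fT gU mTU) _.
    apply: (@le_trans _ _ (2 * ((2 * rho) / kappa) * (2 * d) ^+ m)).
      rewrite ler_wpM2r ?exprn_ge0 ?mulr_ge0 ?(ltW d0)// ler_wpM2l//.
      rewrite ler_wpM2r ?invr_ge0 ?(ltW kappa0)//.
      have : d <= m%:R * d by rewrite ler_peMl ?(ltW d0)// ler1n.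
      by move: drho; lra.
    rewrite /lam /rho exprMn exprD le_eqVlt; apply/orP; left; apply/eqP.
    by field; rewrite !gt_eqF// exprn_gt0.
  - by move=> T U; exact: overlap_cells.
have slabE : slab_bound rho * l ^+ m.-1 <= 4 * m%:R * ((8 * m + 3)%:R * L.+1%:R)
    * (196 * m%:R ^+ 2 * 2 ^+ (m + 5) / kappa) ^+ m.-1.
  have m1 : 1 <= m%:R :> R by rewrite ler1n.
  have h1 : (L + 8 * m + 3)%:R <= (8 * m + 3)%:R * L.+1%:R :> R.
    by rewrite -natrM ler_nat mulnS -addnA addnC leq_add2l leq_pmull// addn3.
  have h2 : (4 * m%:R * (48 * m%:R * d / rho) / d + 4) * l <=
      196 * m%:R ^+ 2 * 2 ^+ (m + 5) / kappa.
    rewrite (_ : _ / d = 192 * m%:R ^+ 2 / rho); last by field; rewrite !gt_eqF.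
    apply: (@le_trans _ _ (196 * m%:R ^+ 2 / rho * l)).
      rewrite ler_wpM2r ?(ltW l0)//.
      have : 1 <= m%:R ^+ 2 / rho.
        by rewrite ler_pdivlMr// mul1r (le_trans rho1)// exprn_ege1.
      lra.
    rewrite /rho le_eqVlt; apply/orP; left; apply/eqP.
    by field; rewrite !gt_eqF.
  rewrite /slab_bound -mulrA -exprMn; apply: ler_pM => //.
  - by rewrite exprn_ge0// mulr_ge0 ?(ltW l0).
  - by rewrite ler_wpM2l// mulr_ge0.
  - have h3 : 0 <= (4 * m%:R * (48 * m%:R * d / rho) / d + 4) * l.
      by rewrite mulr_ge0 ?(ltW l0).
    by rewrite lerXn2r// nnegrE// (le_trans h3).
have lm : l ^+ m.+1 = l ^+ 2 * l ^+ m.-1 by rewrite -exprD add2n prednK.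
have lp : 0 <= l ^+ m.-1 by rewrite exprn_ge0 ?(ltW l0).
rewrite -(ler_pM2r (exprn_gt0 2 dm0)).
have -> : mu1 * mu2 * l ^+ m.+1 * (d ^+ m) ^+ 2 = mu1 * mu2 * lam ^+ 2 * l ^+ m.-1.
  by rewrite lm /lam; ring.
apply: le_trans (ler_wpM2r lp key) _.
have -> : 128 * (8 * (2 * d) ^+ m * (d / kappa)) *
    (M * (8 * (2 * d) ^+ m * slab_bound rho)) * N1 * l ^+ m.-1 =
  (slab_bound rho * l ^+ m.-1) *
    (128 * (8 * (2 * d) ^+ m * (d / kappa)) * (M * (8 * (2 * d) ^+ m)) * N1).
  by ring.
have q0 : 0 <= 128 * (8 * (2 * d) ^+ m * (d / kappa)) * (M * (8 * (2 * d) ^+ m)) * N1.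
  apply: mulr_ge0 => //; apply: mulr_ge0; last exact: mulr_ge0.
  by apply: mulr_ge0 => //; apply: mulr_ge0 => //; rewrite divr_ge0// ltW.
apply: le_trans (ler_wpM2r q0 slabE) _.
rewrite (exprMn m 2 d) le_eqVlt; apply/orP; left; apply/eqP.
set a := d ^+ m; set b := _ ^+ m.-1; set c := 2 ^+ m.
by clearbody a b c; ring.
Qed.


Definition level_const : R := 1 + narrow_const + wide_const.

Lemma narrow_const_ge0 : 0 <= narrow_const.
Proof.
have p0 : 0 <= 2 ^+ (m + 5) :> R by rewrite exprn_ge0.
apply: mulr_ge0; first by rewrite exprn_ge0// mulr_ge0.
by apply: exprn_ge0; rewrite divr_ge0 ?(ltW kappa0)// mulr_ge0// mulr_ge0.
Qed.

Lemma wide_const_ge0 : 0 <= wide_const.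
Proof.
have p0 k : 0 <= 2 ^+ k :> R by rewrite exprn_ge0.
have k0 := ltW kappa0.
apply: mulr_ge0; first by rewrite mulr_ge0// divr_ge0// mulr_ge0.
apply: mulr_ge0; first by rewrite mulr_ge0.
apply: mulr_ge0; first by rewrite mulr_ge0// mulr_ge0.
have m2 : 0 <= m%:R ^+ 2 :> R by rewrite exprn_ge0.
by apply: exprn_ge0; rewrite divr_ge0// mulr_ge0// mulr_ge0.
Qed.

Lemma level_const_ge1 : 1 <= level_const.
Proof.
by rewrite /level_const -addrA lerDl addr_ge0 ?narrow_const_ge0 ?wide_const_ge0.
Qed.

(** With l = mu2 V / (d^m N2), both cases bound mu1 mu2 l^(m+1) by a multiple of
    (L + 1) d N1 M. *)
Lemma level_estimate : mu1 * mu2 * (mu2 * V) ^+ m.+1 <=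
  level_const * L.+1%:R * d ^+ (1 + m * m.+1) * N1 * N2 ^+ m.+1 * M.
Proof.
have N10 : 0 <= N1 by apply: sumr_ge0.
have N20 : 0 <= N2 by apply: sumr_ge0.
have c1 := level_const_ge1.
have L1 : 1 <= L.+1%:R :> R by rewrite ler1n.
pose x := d * N1 * M.
have x0 : 0 <= x by apply: mulr_ge0 => //; apply: mulr_ge0 => //; exact: ltW.
have rhsE : level_const * L.+1%:R * d ^+ (1 + m * m.+1) * N1 * N2 ^+ m.+1 * M =
  (level_const * L.+1%:R * x) * (d ^+ m * N2) ^+ m.+1.
  by rewrite exprMn -exprM exprD expr1 /x; ring.
have dm0 : 0 < d ^+ m by rewrite exprn_gt0.
rewrite rhsE.
have := vol_ge0 level_set; rewrite le_eqVlt => /predU1P[<-|V0].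
  rewrite mulr0 expr0n mulr0 mulr_ge0//; last by rewrite exprn_ge0// mulr_ge0// ltW.
  by rewrite mulr_ge0// mulr_ge0// (le_trans ler01).
have ne : level_set !=set0.
  by apply/set0P/eqP => e; move: V0; rewrite e /vol measure0/= ltxx.
have N2p : 0 < N2.
  case: ne => y [_ /andP[Gy _]].
  exact: lt_trans mu20 (lt_le_trans Gy (Xstar_le_sum y g0)).
pose l := mu2 * V / (d ^+ m * N2).
have dN : 0 < d ^+ m * N2 by rewrite mulr_gt0.
have lE : mu2 * V = l * (d ^+ m * N2) by rewrite /l divfK ?gt_eqF.
have l0 : 0 <= l by rewrite divr_ge0 ?mulr_ge0 ?(ltW V0) ?(ltW dm0) ?(ltW mu20).
rewrite lE exprMn mulrA ler_wpM2r ?exprn_ge0 ?(ltW dN)//.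
have n0 := narrow_const_ge0; have w0 := wide_const_ge0.
(* The threshold at which rho = l * kappa / 2^(m+5) can be used as radius. *)
have [h|h] := leP (l * kappa / 2 ^+ (m + 5)) (6 * m%:R * d).
  apply: le_trans (level_set_narrow l0 ne h) _.
  have -> : narrow_const * d * N1 * M = narrow_const * x by rewrite /x !mulrA.
  rewrite ler_wpM2r//; apply: (@le_trans _ _ level_const).
    by rewrite /level_const; lra.
  by rewrite ler_peMr// (le_trans ler01).
apply: le_trans (level_set_wide V0 _ (ltW h)) _; first by rewrite lE mulrA.
have -> : wide_const * L.+1%:R * d * N1 * M = wide_const * L.+1%:R * x.
  by rewrite /x !mulrA.
rewrite ler_wpM2r// ler_wpM2r//.
by rewrite /level_const; lra.
Qed.

End level_sets.

(** * From level sets to the bilinear integral *)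

Lemma exponent_le m : ((1 + m * m.+1) * 2 <= 2 * m.+1 * m.+3)%N.
Proof. by nia. Qed.

Lemma half_exponent_le m : (0 < m)%N -> (m.+3 <= 2 * m.+1)%N.
Proof. by lia. Qed.

Section bilinear.
Context {R : realType} (m : nat).
Local Notation RR := (measurableTypeR R).
Local Notation X := (m.-tuple RR * RR)%type.
Hypothesis m0 : (0 < m)%N.
Variables (d kappa : R) (L : nat) (E : {fset m.-tuple R}).
Hypothesis d0 : 0 < d.
Hypothesis d1 : d <= 1.
Hypothesis dL : 1 <= d * 2 ^+ L.
Hypothesis Ecube : forall w : E, cube (val w).
Hypothesis Esep : Defs.separated d [set` E].
Hypothesis kappa0 : 0 < kappa.
Hypothesis kappa1 : kappa <= 1.

Local Notation dir T := (tnth (val T.1)).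
Local Notation C := (level_const m kappa).
Local Notation r := (m.+3%:R / (2 * m.+1%:R) : R).
Local Notation nu := ((2 * m.+1%:R)^-1 : R).

Definition transverse_weights (f g : E * E -> R) :=
  forall T U, 0 < f T -> 0 < g U ->
  exists2 j, kappa <= `|dir U j - dir T j| &
    forall k, `|dir U k - dir T k| <= `|dir U j - dir T j|.

Lemma transverse_weightsC f g : transverse_weights f g -> transverse_weights g f.
Proof.
move=> h T U gT fU; have [j kj jmax] := h _ _ fU gT; exists j.
  by rewrite distrC.
by move=> k; rewrite distrC (distrC (dir U j)).
Qed.

Lemma powR_nu x k : 0 <= x -> (x ^+ k) `^ nu = x `^ (k%:R * nu).
Proof. by move=> x0; rewrite powRrM powR_mulrn. Qed.

Section pieces.
Variables (f g : E * E -> R) (M1 M2 P1 P2 : R).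
Hypothesis f0 : forall T, 0 <= f T.
Hypothesis g0 : forall U, 0 <= g U.
Hypothesis M10 : 0 <= M1.
Hypothesis M20 : 0 <= M2.
Hypothesis fM : forall w, \sum_i f (w, i) <= M1.
Hypothesis gM : forall w, \sum_i g (w, i) <= M2.
Hypothesis fg : transverse_weights f g.
Hypothesis fP : (\sum_T f T) ^+ m.+2 * M1 <= P1.
Hypothesis gP : (\sum_T g T) ^+ m.+2 * M2 <= P2.

Local Notation N1 := (\sum_T f T).
Local Notation N2 := (\sum_T g T).

Definition level_bound : R := (C * L.+1%:R * d ^+ (1 + m * m.+1)) ^+ 2 * (P1 * P2).

(** The estimate for (f, g) multiplied by the one for (g, f); in the product the
    total and maximal weights combine to the quantities bounded by [P1] and
    [P2]. *)
Lemma bilinear_level_estimate mu1 mu2 : 0 < mu1 -> 0 < mu2 ->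
  (mu1 * mu2) ^+ m.+3 * vol (level_set d f g mu1 mu2) ^+ (2 * m.+1) <= level_bound.
Proof.
move=> mu10 mu20.
have e2 := level_estimate m0 d0 d1 dL Ecube Esep kappa0 kappa1 f0 g0
  mu10 mu20 M20 gM fg.
have e1 := level_estimate m0 d0 d1 dL Ecube Esep kappa0 kappa1 g0 f0
  mu20 mu10 M10 fM (transverse_weightsC fg).
have sC : level_set d g f mu2 mu1 = level_set d f g mu1 mu2.
  by apply/seteqP; split => x [? ?]; split.
rewrite sC in e1; move: e1 e2.
set V := vol _; set D := d ^+ _; set c := C * _ => e1 e2.
have V0 : 0 <= V := vol_ge0 _.
have N10 : 0 <= N1 by apply: sumr_ge0.
have N20 : 0 <= N2 by apply: sumr_ge0.
have l1 : 0 <= mu2 * mu1 * (mu1 * V) ^+ m.+1.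
  by rewrite mulr_ge0 ?exprn_ge0 ?mulr_ge0 ?(ltW mu10) ?(ltW mu20).
have l2 : 0 <= mu1 * mu2 * (mu2 * V) ^+ m.+1.
  by rewrite mulr_ge0 ?exprn_ge0 ?mulr_ge0 ?(ltW mu10) ?(ltW mu20).
have := ler_pM l1 l2 e1 e2.
have -> : mu2 * mu1 * (mu1 * V) ^+ m.+1 * (mu1 * mu2 * (mu2 * V) ^+ m.+1) =
    (mu1 * mu2) ^+ m.+3 * V ^+ (2 * m.+1).
  rewrite mulnC exprM !exprS !exprMn; ring.
move=> /le_trans; apply; rewrite /level_bound -/D -/c.
have -> : c * D * N2 * N1 ^+ m.+1 * M1 * (c * D * N1 * N2 ^+ m.+1 * M2) =
   (c * D) ^+ 2 * (N1 ^+ m.+2 * M1 * (N2 ^+ m.+2 * M2)).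
  by rewrite (exprS N1 m.+1) (exprS N2 m.+1); ring.
rewrite ler_wpM2l ?sqr_ge0//; apply: ler_pM => //; by rewrite mulr_ge0// exprn_ge0.
Qed.

Local Notation cells := {set bool * (E * E)}.

(** The cells are those for rho = 0; any radius gives the same sum.  The
    hypothesis says that the part of the integral below the lowest dyadic levels
    is already dominated by the bound for one level. *)
Lemma pieces_sum_le (J : nat) :
  (N1 * N2 / 2 ^+ J) ^+ m.+3 <= level_bound ->
  \sum_(s : cells) cell_vol d 0 s * ((\sum_T f T * (cell_tube T s)%:R) *
     (\sum_T g T * (cell_tube T s)%:R)) `^ r <=
  (J%:R ^+ 2 * 4 `^ r + \sum_(s : cells) cell_vol d 0 s) * level_bound `^ nu.
Proof.
move=> tailJ.
have N10 : 0 <= N1 by apply: sumr_ge0.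
have N20 : 0 <= N2 by apply: sumr_ge0.
have nu0 : 0 <= nu by rewrite invr_ge0 mulr_ge0.
have r0 : 0 < r by rewrite divr_gt0// mulr_gt0.
have v0 (s : cells) : 0 <= cell_vol d 0 s := vol_ge0 _.
have mono (x y : R) : 0 <= x -> x <= y -> x `^ nu <= y `^ nu.
  move=> x0 xy; apply: ge0_ler_powR => //; rewrite ?nnegrE//.
  exact: le_trans xy.
have bnd (h : E * E -> R) s : (forall T, 0 <= h T) ->
    0 <= \sum_T h T * (cell_tube T s)%:R <= \sum_T h T.
  move=> h0; apply/andP; split; first by apply: sumr_ge0 => T _; rewrite mulr_ge0.
  by apply: ler_sum => T _; rewrite ler_piMr//; case: cell_tube.
apply: le_trans (sum_powR_le_levels J v0 (fun s => bnd f s f0)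
  (fun s => bnd g s g0) N10 N20 r0 (powR_ge0 level_bound nu) _) _.
- move=> mu1 mu2 mu10 mu20.
  have -> : \sum_(s : cells | (mu1 < \sum_T f T * (cell_tube T s)%:R <= 2 * mu1) &&
      (mu2 < \sum_T g T * (cell_tube T s)%:R <= 2 * mu2)) cell_vol d 0 s =
      vol (level_set d f g mu1 mu2).
    exact: (sum_level_cells d1 Ecube f g mu2 mu10 0).
  set V := vol _; have V0 : 0 <= V := vol_ge0 _.
  have -> : (mu1 * mu2) `^ r * V = ((mu1 * mu2) ^+ m.+3 * V ^+ (2 * m.+1)) `^ nu.
    rewrite [RHS]powRM ?exprn_ge0 ?mulr_ge0 ?(ltW mu10) ?(ltW mu20)//.
    rewrite !powR_nu ?mulr_ge0 ?(ltW mu10) ?(ltW mu20)//.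
    by rewrite natrM mulfV ?mulf_neq0 ?pnatr_eq0// powRr1.
  apply: mono; last exact: bilinear_level_estimate.
  by rewrite mulr_ge0// exprn_ge0// mulr_ge0// ltW.
rewrite [leRHS]mulrDl lerD2l ler_wpM2l ?sumr_ge0//.
have -> : (N1 * N2 / 2 ^+ J) `^ r = ((N1 * N2 / 2 ^+ J) ^+ m.+3) `^ nu.
  by rewrite powR_nu// divr_ge0 ?mulr_ge0// exprn_ge0.
by apply: mono => //; rewrite exprn_ge0// divr_ge0 ?mulr_ge0// exprn_ge0.
Qed.

End pieces.

Local Notation cells := {set bool * (E * E)}.
Local Notation fiber_power_sum f :=
  (\sum_w (\sum_i f (w, i)) `^ (m.+3%:R / m.+2%:R)).
Local Notation J0 := ((22 * m + L) * m)%N.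
Local Notation J := (2 * J0 + 2 * m.+1 * L)%N.

Lemma net_card_le : #|{: E}|%:R <= 2 ^+ J0 :> R.
Proof.
have dV : d^-1 <= 2 ^+ L by rewrite -(ler_pM2l d0) mulfV ?gt_eqF.
apply: (@le_trans _ _ ((22 * m%:R / d) ^+ m)).
  apply: (@separated_card_le R m _ (fun (x : E) k => tnth (val x) k)) => //.
  move=> y z yz; have := Esep (valP y) (valP z); rewrite /edist /enorm; apply.
  by apply: contra yz => /eqP/val_inj ->.
have p0 : 0 <= 22 * m%:R / d by rewrite divr_ge0 ?(ltW d0)// mulr_ge0.
rewrite exprM lerXn2r// ?nnegrE// ?exprn_ge0// exprD; apply: ler_pM => //.
- by rewrite invr_ge0 ltW.
- by rewrite -natrM -natrX ler_nat ltnW// ltn_expl.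
Qed.

(** This explains the number [J] of dyadic levels: 2 J0 levels compensate the
    passage from total weights to power sums, for a net of at most 2^J0 points,
    and 2 (m + 1) L levels compensate the powers of d, which is at least 2^-L. *)
Lemma tail_le (n1 n2 A1 A2 : R) : 0 <= n1 -> 0 <= n2 -> 0 <= A1 -> 0 <= A2 ->
  n1 ^+ m.+3 <= (2 ^+ J0) ^+ m.+3 * A1 ^+ m.+2 ->
  n2 ^+ m.+3 <= (2 ^+ J0) ^+ m.+3 * A2 ^+ m.+2 ->
  (n1 * n2 / 2 ^+ J) ^+ m.+3 <=
  level_bound (2 ^+ m.+3 * A1 ^+ m.+2) (2 ^+ m.+3 * A2 ^+ m.+2).
Proof.
move=> n10 n20 A10 A20 h1 h2.
have a10 : 0 <= A1 ^+ m.+2 by rewrite exprn_ge0.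
have a20 : 0 <= A2 ^+ m.+2 by rewrite exprn_ge0.
have p1 k : 1 <= 2 ^+ k :> R by rewrite exprn_ege1// ler1n.
have p0 k : 0 < 2 ^+ k :> R by rewrite exprn_gt0.
rewrite expr_div_n exprMn.
apply: (@le_trans _ _ (d ^+ (1 + m * m.+1) ^+ 2 * (A1 ^+ m.+2 * A2 ^+ m.+2))).
  rewrite ler_pdivrMr ?exprn_gt0//.
  apply: (@le_trans _ _ ((2 ^+ J0) ^+ m.+3 * A1 ^+ m.+2 *
      ((2 ^+ J0) ^+ m.+3 * A2 ^+ m.+2))).
    by apply: ler_pM => //; rewrite exprn_ge0.
  have -> : (2 ^+ J0) ^+ m.+3 * A1 ^+ m.+2 * ((2 ^+ J0) ^+ m.+3 * A2 ^+ m.+2) =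
      (2 ^+ (2 * J0)) ^+ m.+3 * (A1 ^+ m.+2 * A2 ^+ m.+2).
    by rewrite mul2n -addnn exprD exprMn; ring.
  rewrite (exprD 2 (2 * J0)%N (2 * m.+1 * L)%N) (exprMn m.+3).
  set t := (2 ^+ (2 * J0)) ^+ m.+3; set u := (2 ^+ (2 * m.+1 * L)) ^+ m.+3.
  set y := A1 ^+ m.+2 * _; set D := d ^+ _.
  have y0 : 0 <= y by exact: mulr_ge0.
  have ty0 : 0 <= t * y by rewrite mulr_ge0// /t -exprM exprn_ge0.
  have -> : D ^+ 2 * y * (t * u) = t * y * (D ^+ 2 * u) by ring.
  rewrite ler_peMr// /D /u -!exprM.
  apply: (@le_trans _ _ ((d * 2 ^+ L) ^+ ((1 + m * m.+1) * 2))).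
    by rewrite exprn_ege1.
  rewrite exprMn ler_wpM2l ?exprn_ge0 ?(ltW d0)// -!exprM.
  by rewrite ler_weXn2l ?ler1n// (mulnC L) (mulnAC _ L) leq_mul2r exponent_le orbT.
have cL : 1 <= C * L.+1%:R.
  by rewrite mulr_ege1 ?level_const_ge1// ler1n.
rewrite /level_bound exprMn; set D := (d ^+ _) ^+ 2; set y := _ * A2 ^+ m.+2.
have Dy : 0 <= D * y by rewrite mulr_ge0 ?sqr_ge0// mulr_ge0.
have -> : (C * L.+1%:R) ^+ 2 * D * (2 ^+ m.+3 * A1 ^+ m.+2 * (2 ^+ m.+3 * A2 ^+ m.+2))
    = D * y * ((C * L.+1%:R) ^+ 2 * (2 ^+ m.+3 * 2 ^+ m.+3)).
  by rewrite /y; ring.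
by rewrite ler_peMr// mulr_ege1 ?p1// ?exprn_ege1// mulr_ege1 ?p1.
Qed.

Lemma box_volume (rho : R) :
  \sum_(s : cells) cell_vol d rho s <= 2 * (6 * m%:R) ^+ m.
Proof.
rewrite (sum_cell_vol d rho predT).
rewrite (_ : 2 * _ = (1 - (-1)) * (2 * (3 * m%:R)) ^+ m); last first.
  by congr (_ * _ ^+ _); ring.
apply: (vol_le (w := [tuple of nseq m 0]) (i := [tuple of nseq m 0])
  (measurable_cells d rho predT)).
- lra.
- by rewrite mulr_ge0.
- by move=> x [].
Qed.

Lemma integral_Xstar_powR (f g : E * E -> R) :
  (forall T, 0 <= f T) -> (forall U, 0 <= g U) ->
  (\int[lebesgue_tuple m \x @lebesgue_measure R]_x
     (`|(Xstar d f x * Xstar d g x)%:E| `^ r))%E =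
  (\sum_(s : cells) cell_vol d 0 s * ((\sum_T f T * (cell_tube T s)%:R) *
     (\sum_T g T * (cell_tube T s)%:R)) `^ r)%:E.
Proof.
move=> f0 g0.
pose sig := signature (cell_family d 0 (E := E)).
pose F s := \sum_T f T * (cell_tube T s)%:R.
pose G s := \sum_T g T * (cell_tube T s)%:R.
have r0 : r != 0 by rewrite mulf_neq0// ?invr_eq0 ?mulf_neq0 ?pnatr_eq0.
have msig s : measurable (sig @^-1` [set s]).
  by apply: measurable_signature => h; exact: measurable_cell_family.
have mB : measurable (@support_box R m) by exact: measurable_sheared_slab.
transitivity (\int[lebesgue_tuple m \x @lebesgue_measure R]_(x in @support_box R m)
    ((F (sig x) * G (sig x)) `^ r)%:E)%E.
  rewrite [RHS]integral_mkcond; apply: eq_integral => x _.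
  have FG0 : 0 <= F (sig x) * G (sig x).
    by rewrite mulr_ge0//; apply: sumr_ge0 => T _; rewrite mulr_ge0.
  rewrite (Xstar_sig d 0 f) (Xstar_sig d 0 g) -/sig -/(F (sig x)) -/(G (sig x)).
  rewrite patchE; case: ifPn => [_|xB].
    by rewrite /= ger0_norm.
  have -> : F (sig x) = 0.
    rewrite /F big1// => T _; rewrite cell_tubeE; case: asboolP => [Tx|_].
      by move/negP: xB; case; rewrite inE; exact: tube_sub_box Tx.
    by rewrite mulr0.
  by rewrite mul0r /= normr0 powR0.
rewrite (integral_fiber _ msig (h := fun s => (F s * G s) `^ r))//; last first.
  by move=> s; exact: powR_ge0.
rewrite -sumEFin; apply: eq_bigr => s _.
rewrite EFinM muleC; congr (_ * _)%E; rewrite /cell_vol /vol fineK//.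
rewrite ge0_fin_numE//; apply: sheared_slab_fin.
  by apply: measurableI => //; exact: msig.
by move=> x [_ h]; exact: h.
Qed.

Lemma bilinear_sum_le (f g : E * E -> R) :
  (forall T, 0 <= f T) -> (forall U, 0 <= g U) -> transverse_weights f g ->
  \sum_(s : cells) cell_vol d 0 s * ((\sum_T f T * (cell_tube T s)%:R) *
     (\sum_T g T * (cell_tube T s)%:R)) `^ r <=
  J0.+1%:R ^+ 2 * ((J%:R ^+ 2 * 4 `^ r + 2 * (6 * m%:R) ^+ m) *
    level_bound (2 ^+ m.+3 * fiber_power_sum f ^+ m.+2)
      (2 ^+ m.+3 * fiber_power_sum g ^+ m.+2) `^ nu).
Proof.
move=> f0 g0 fg.
have [fk [M1 [fkf ffk M10 fkM fkP]]] := weight_pieces m f0 net_card_le.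
have [gk [M2 [gkg ggk M20 gkM gkP]]] := weight_pieces m g0 net_card_le.
have r01 : 0 < r <= 1.
  apply/andP; split; first by rewrite divr_gt0// mulr_gt0.
  by rewrite ler_pdivrMr ?mulr_gt0// mul1r -natrM ler_nat half_exponent_le.
have ind0 (h : E * E -> R) s : (forall T, 0 <= h T) ->
    0 <= \sum_T h T * (cell_tube T s)%:R.
  by move=> h0; apply: sumr_ge0 => T _; rewrite mulr_ge0.
have split_le (h : E * E -> R) (hk : 'I_J0.+1 -> E * E -> R) s :
    (forall T, 0 <= h T) -> (forall T, h T <= \sum_k hk k T) ->
    0 <= \sum_T h T * (cell_tube T s)%:R <=
      \sum_k \sum_T hk k T * (cell_tube T s)%:R.
  move=> h0 hhk; rewrite ind0//= exchange_big/=; apply: ler_sum => T _.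
  by rewrite -mulr_suml ler_wpM2r.
have fk0 k T : 0 <= fk k T by case/andP: (fkf k T).
have gk0 k T : 0 <= gk k T by case/andP: (gkg k T).
apply: le_trans (sum_powR_le_pieces
  (Fk := fun k s => \sum_T fk k T * (cell_tube T s)%:R)
  (Gk := fun k s => \sum_T gk k T * (cell_tube T s)%:R) r01 _ _ _ _ _) _.
- by move=> s; exact: vol_ge0.
- by move=> s; exact: split_le.
- by move=> s; exact: split_le.
- by move=> k s; exact: ind0.
- by move=> k s; exact: ind0.
set b := _ `^ nu.
have -> : J0.+1%:R ^+ 2 * ((J%:R ^+ 2 * 4 `^ r + 2 * (6 * m%:R) ^+ m) * b) =
    \sum_(k < J0.+1) \sum_(l < J0.+1) ((J%:R ^+ 2 * 4 `^ r + 2 * (6 * m%:R) ^+ m) * b).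
  by rewrite !sumr_const !card_ord -mulrnA -[RHS]mulr_natl natrM expr2 !mulrA.
apply: ler_sum => k _; apply: ler_sum => l _.
have total (h hk : E * E -> R) : (forall T, 0 <= h T) ->
    (forall T, 0 <= hk T <= h T) ->
    (\sum_T hk T) ^+ m.+3 <= (2 ^+ J0) ^+ m.+3 * fiber_power_sum h ^+ m.+2.
  move=> h0 hkh; apply: (@le_trans _ _ ((\sum_T h T) ^+ m.+3)).
    rewrite lerXn2r// ?nnegrE ?sumr_ge0// => [T _|]; first by case/andP: (hkh T).
    by apply: ler_sum => T _; case/andP: (hkh T).
  apply: le_trans (weight_total m h0) _.
  rewrite ler_wpM2r ?exprn_ge0 ?sumr_ge0// => [w _|]; first exact: powR_ge0.
  by rewrite lerXn2r// ?nnegrE ?exprn_ge0// net_card_le.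
have fps0 (h : E * E -> R) : 0 <= fiber_power_sum h.
  by apply: sumr_ge0 => w _; exact: powR_ge0.
apply: le_trans (pieces_sum_le (fk0 k) (gk0 l) (M10 k) (M20 l) (fkM k) (gkM l)
  _ (fkP k) (gkP l) (J := J) _) _.
- move=> T U fT gU; apply: fg.
    by apply: lt_le_trans fT _; case/andP: (fkf k T).
  by apply: lt_le_trans gU _; case/andP: (gkg l U).
- by apply: tail_le => //; rewrite ?sumr_ge0//; apply: total.
by rewrite ler_wpM2r ?powR_ge0// lerD2l box_volume.
Qed.

End bilinear.

(** * Logarithms, exponents and the conclusion *)

Section constants.
Variable R : realType.

Lemma exists_dyadic_scale (d : R) : 0 < d < 1 ->
  exists L : nat, 1 <= d * 2 ^+ L <= 2.
Proof.
move=> /andP[d0 d1].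
have ex : exists L, 1 <= d * 2 ^+ L.
  exists (Num.bound d^-1); rewrite -ler_pdivrMl// mulr1.
  by apply: ltW; apply: upper_nthrootP.
exists (ex_minn ex); case: ex_minnP => -[|L] hL minL; rewrite hL/=.
  by rewrite expr0 mulr1 (le_trans (ltW d1))// ler1n.
rewrite leNgt; apply/negP => h; suff : (L.+1 <= L)%N by rewrite ltnn.
apply: minL; apply: ltW; rewrite -(ltr_pM2l (ltr0Sn R 1)) mulr1.
by rewrite mulrCA -exprS.
Qed.

Lemma linear_le_power (b : R) : 1 < b ->
  exists2 c, 0 < c & forall L : nat, L.+1%:R <= c * b ^+ L.
Proof.
move=> b1; have b0 : 0 < b := lt_trans ltr01 b1.
pose t := Num.min 1 (b - 1); have t0 : 0 < t by rewrite lt_min ltr01 subr_gt0.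
exists t^-1 => [|L]; first by rewrite invr_gt0.
rewrite mulrC ler_pdivlMr//.
have t1 : t <= 1 by rewrite ge_min lexx.
have tb : t <= b - 1 by rewrite ge_min lexx orbT.
elim: L => [|L IH]; first by rewrite mul1r expr0.
rewrite -natr1 mulrDl mul1r exprSr.
have bL : 1 <= b ^+ L by rewrite exprn_ege1// ltW.
nra.
Qed.

(** Powers of the logarithm are absorbed by d^(-eps): L + 1 is at most a multiple
    of any exponential b^L with b > 1, and b is taken as 2^(eps / (k q + 1)). *)
Lemma polylog_le (eps q : R) (k : nat) : 0 < eps -> 0 <= q ->
  exists2 c, 0 < c &
  forall L : nat, (L.+1%:R ^+ k) `^ q <= c * (2 ^+ L) `^ eps.
Proof.
move=> eps0 q0; pose u := eps / (k%:R * q + 1).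
have kq : 0 < k%:R * q + 1 by rewrite ltr_wpDl// mulr_ge0.
have u0 : 0 < u by rewrite divr_gt0.
have b1 : 1 < (2 : R) `^ u.
  rewrite -[ltLHS](powRr0 (2 : R)) /powR pnatr_eq0/= ltr_expR ltr_pM2r//.
  by rewrite ln_gt0// ltr1n.
have [c c0 hc] := linear_le_power b1.
exists (c `^ (k%:R * q)) => [|L]; first exact: powR_gt0.
have -> : (L.+1%:R ^+ k : R) `^ q = L.+1%:R `^ (k%:R * q).
  by rewrite powRrM powR_mulrn.
apply: (@le_trans _ _ ((c * (2 `^ u) ^+ L) `^ (k%:R * q))).
  by apply: ge0_ler_powR; rewrite ?nnegrE ?mulr_ge0 ?exprn_ge0 ?powR_ge0 ?(ltW c0).
rewrite powRM ?(ltW c0) ?exprn_ge0 ?powR_ge0// ler_wpM2l ?powR_ge0//.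
rewrite -powR_mulrn ?powR_ge0// -!powRrM -powR_mulrn// -powRrM.
apply: ler_powR; first by rewrite ler1n.
have h : u * (k%:R * q) <= eps.
  rewrite /u mulrAC ler_pdivrMr// ler_pM2l// lerDl; exact: ler01.
by rewrite mulrCA ler_wpM2l.
Qed.

Lemma hoelder_conjugate_exponent (n : nat) : (2 <= n)%N ->
  fine (hoelder_conjugate (2%:E * ((n%:R + 2) / (2 * n%:R))%:E : \bar R))^-1 =
  2 / (n%:R + 2).
Proof.
move=> n2; have n0 : 0 < n%:R :> R by rewrite ltr0n (leq_trans _ n2).
have n20 : 0 < n%:R + 2 :> R by rewrite ltr_wpDr.
pose x : R := (n%:R + 2) / n%:R.
have -> : (2%:E * ((n%:R + 2) / (2 * n%:R))%:E)%E = x%:E.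
  by rewrite -EFinM; congr EFin; rewrite /x; field; rewrite gt_eqF.
have x0 : x != 0 by rewrite mulf_neq0// ?invr_eq0 gt_eqF.
have x1 : x - 1 = 2 / n%:R by rewrite /x; field; rewrite gt_eqF.
have x10 : x - 1 != 0 by rewrite x1 mulf_neq0// invr_eq0 gt_eqF.
rewrite /hoelder_conjugate /= eqe (negbTE x0).
rewrite -EFinB inver (negbTE x10) -EFinM inver.
rewrite mulf_eq0 invr_eq0 (negbTE x0) (negbTE x10)/= invf_div x1 /x.
by field; rewrite !gt_eqF.
Qed.

Lemma mixed_norm_L1 (m : nat) (d s : R) (E : {fset m.-tuple R})
    (f : E * E -> R) : (forall T, 0 <= f T) ->
  mixed_norm d s%:E 1 f =
  (d ^+ m * \sum_(w : E) (\sum_(i : E) f (w, i)) `^ s) `^ s^-1.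
Proof.
move=> f0; rewrite /mixed_norm/=; congr ((_ * _) `^ _).
have e (w : E) : (1 * \sum_(i : E) `|f (w, i)| `^ 1) `^ 1^-1 = \sum_(i : E) f (w, i).
  rewrite mul1r invr1 powRr1; last first.
    by apply: sumr_ge0 => i _; exact: powR_ge0.
  by apply: eq_bigr => i _; rewrite powRr1// ger0_norm.
by apply: eq_bigr => w _; rewrite e ger0_norm// sumr_ge0.
Qed.

End constants.

(** The coordinate in which two directions differ most accounts for at least the
    fraction 1 / m of their distance.  The minimum with 1 only serves to normalise
    [kappa]. *)
Lemma set_dist_transverse (R : realType) (m : nat) (K : R) (E : {fset m.-tuple R})
    (E1 E2 : {set E}) (f g : E * E -> R) : (0 < m)%N -> 0 < K ->
  K^-1 <= set_dist [set val w | w in [set` E1]] [set val w | w in [set` E2]] ->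
  (forall w i, w \notin E1 -> f (w, i) = 0) ->
  (forall w i, w \notin E2 -> g (w, i) = 0) ->
  transverse_weights (Num.min 1 (m%:R * K)^-1) f g.
Proof.
move=> m0 K0 hd fE gE T U fT gU.
have TE : T.1 \in E1.
  apply: contraPT (fT) => /(fE _ T.2); rewrite -surjective_pairing => ->.
  by rewrite ltxx.
have UE : U.1 \in E2.
  apply: contraPT (gU) => /(gE _ U.2); rewrite -surjective_pairing => ->.
  by rewrite ltxx.
have [j jmax jge] := exists_coord_ge
  (fun k => tnth (val U.1) k - tnth (val T.1) k) m0.
exists j => //; rewrite ge_min; apply/orP; right.
rewrite invfM ler_pdivrMl ?ltr0n//; apply: le_trans jge; apply: le_trans hd _.
apply: ge_inf.
  by exists 0 => _ [a _ [b _ <-]]; rewrite /edist sqrtr_ge0.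
exists (val T.1); first by exists T.1.
exists (val U.1); first by exists U.1.
by rewrite /edist /enorm; congr Num.sqrt; apply: eq_bigr => k _; rewrite -sqrrN opprB.
Qed.

Lemma index_count_le p m L : (((p + L) * m).+1 <= (p.+1 * m).+1 * L.+1)%N.
Proof. by nia. Qed.

Section final.
Variables (R : realType) (m : nat) (kappa : R).
Hypothesis m0 : (0 < m)%N.
Hypothesis kappa0 : 0 < kappa.
Local Notation C := (level_const m kappa).
Local Notation r := (m.+3%:R / (2 * m.+1%:R) : R).
Local Notation nu := ((2 * m.+1%:R)^-1 : R).
Local Notation c0 := (((22 * m).+1 * m).+1%:R : R).
Local Notation c1 := (2 * c0 + 2 * m.+1%:R : R).

Definition sum_const : R :=
  c0 ^+ 2 * (c1 ^+ 2 * 4 `^ r + 2 * (6 * m%:R) ^+ m) * (C ^+ 2 * (2 ^+ m.+3) ^+ 2).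

Lemma sum_const_gt0 : 0 < sum_const.
Proof.
have C1 : 1 <= C := level_const_ge1 m kappa0.
apply: mulr_gt0; last by rewrite mulr_gt0 ?exprn_gt0// (lt_le_trans ltr01).
apply: mulr_gt0; first by rewrite exprn_gt0.
apply: ltr_pwDl; last by rewrite mulr_ge0// exprn_ge0// mulr_ge0.
by apply: mulr_gt0; rewrite ?powR_gt0// exprn_gt0// addr_gt0// mulr_gt0.
Qed.

Lemma sum_bound_le (d A1 A2 : R) (L : nat) : 0 < d -> 0 <= A1 -> 0 <= A2 ->
  ((22 * m + L) * m)%N.+1%:R ^+ 2 *
  (((2 * ((22 * m + L) * m) + 2 * m.+1 * L)%N%:R ^+ 2 * 4 `^ r + 2 * (6 * m%:R) ^+ m) *
    level_bound m d kappa L (2 ^+ m.+3 * A1 ^+ m.+2) (2 ^+ m.+3 * A2 ^+ m.+2) `^ nu)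
  <= sum_const * L.+1%:R ^+ 6 *
     ((d ^+ (1 + m * m.+1)) ^+ 2 * (A1 * A2) ^+ m.+2) `^ nu.
Proof.
move=> d0 A10 A20.
set J0 := ((22 * m + L) * m)%N; set l : R := L.+1%:R.
have l1 : 1 <= l by rewrite ler1n.
have l0 : 0 <= l := le_trans ler01 l1.
have C1 : 1 <= C := level_const_ge1 m kappa0.
have J0l : J0.+1%:R <= c0 * l by rewrite -natrM ler_nat index_count_le.
have Jl : (2 * J0 + 2 * m.+1 * L)%N%:R <= c1 * l.
  rewrite natrD mulrDl; apply: lerD.
    by rewrite natrM -mulrA ler_wpM2l// (le_trans _ J0l)// ler_nat.
  by rewrite !natrM ler_wpM2l ?mulr_ge0// ler_nat.
have c00 : 0 <= c0 by [].
have c10 : 0 <= c1 by rewrite addr_ge0// mulr_ge0.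
set D := (d ^+ _) ^+ 2; set Z := D * _.
have Z0 : 0 <= Z by rewrite mulr_ge0 ?sqr_ge0// exprn_ge0// mulr_ge0.
pose W := (C * l) ^+ 2 * (2 ^+ m.+3) ^+ 2.
have W1 : 1 <= W.
  rewrite mulr_ege1// exprn_ege1//; first by rewrite mulr_ege1.
  by rewrite exprn_ege1// ler1n.
have W0 : 0 <= W := le_trans ler01 W1.
have -> : level_bound m d kappa L (2 ^+ m.+3 * A1 ^+ m.+2) (2 ^+ m.+3 * A2 ^+ m.+2)
    = W * Z.
  by rewrite /level_bound /W /Z /D -/l (exprMn _ A1) exprMn; ring.
rewrite powRM// !mulrA ler_wpM2r ?powR_ge0//.
have Wnu : W `^ nu <= W.
  apply: ler1_powR => //; rewrite invf_le1 ?mulr_gt0//.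
  by rewrite -natrM ler1n muln_gt0.
set e := 2 * (6 * m%:R) ^+ m; have e0 : 0 <= e by rewrite mulr_ge0// exprn_ge0// mulr_ge0.
have p4 : 0 <= 4 `^ r :> R := powR_ge0 _ _.
apply: (@le_trans _ _ ((c0 * l) ^+ 2 *
    (((c1 * l) ^+ 2 * 4 `^ r + e * l ^+ 2)) * W)).
  apply: ler_pM; rewrite ?powR_ge0//.
    by rewrite mulr_ge0 ?sqr_ge0// addr_ge0// mulr_ge0// sqr_ge0.
  apply: ler_pM; rewrite ?sqr_ge0//.
  - by rewrite addr_ge0// mulr_ge0// sqr_ge0.
  - by rewrite lerXn2r// nnegrE// mulr_ge0.
  - apply: lerD; last by rewrite ler_peMr// exprn_ege1.
    by rewrite ler_wpM2r// lerXn2r// nnegrE// mulr_ge0.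
rewrite le_eqVlt; apply/orP; left; apply/eqP.
rewrite /sum_const -/e /W; set a := c0; set b := c1; set c := 4 `^ r; set t := 2 ^+ _.
by clearbody a b c t e; ring.
Qed.

(** With n = m + 1 the exponent of d on the left, 2 (1 + m n) / (n + 2), equals
    -4 n / (n + 2) + 2 + 2 m (n + 1) / (n + 2), where the last term comes from the
    normalisation d^m of the counting measure in both mixed norms. *)
Lemma bilinear_power_identity (d A1 A2 : R) : 0 < d -> 0 <= A1 -> 0 <= A2 ->
  (((d ^+ (1 + m * m.+1)) ^+ 2 * (A1 * A2) ^+ m.+2) `^ nu) `^ r^-1 =
  d `^ (- (2 * m.+1%:R * (2 / m.+3%:R)) + 2) *
  (d ^+ m * A1) `^ (m.+3%:R / m.+2%:R)^-1 * (d ^+ m * A2) `^ (m.+3%:R / m.+2%:R)^-1.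
Proof.
move=> d0 A10 A20.
have e1 : nu * r^-1 = (m.+3%:R)^-1.
  by rewrite invf_div mulrA mulVf ?mul1r// mulf_neq0 ?pnatr_eq0.
rewrite -powRrM e1 invf_div; set q := m.+2%:R / m.+3%:R.
have dm : 0 <= d ^+ m by rewrite exprn_ge0// ltW.
rewrite (powRM q dm A10) (powRM q dm A20).
rewrite powRM ?sqr_ge0 ?exprn_ge0 ?mulr_ge0//.
have -> : ((A1 * A2) ^+ m.+2) `^ (m.+3%:R)^-1 = A1 `^ q * A2 `^ q.
  by rewrite -powRM// -powR_mulrn ?mulr_ge0// -powRrM.
rewrite -!exprM -!powR_mulrn ?(ltW d0)// -!powRrM.
set a := d `^ (m%:R * q).
have -> : d `^ (((1 + m * m.+1) * 2)%N%:R * (m.+3%:R)^-1) =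
    d `^ (- (2 * m.+1%:R * (2 / m.+3%:R)) + 2) * (a * a).
  have dn : d != 0 by rewrite gt_eqF.
  rewrite /a -powRD ?dn ?implybT// -powRD ?dn ?implybT//; congr (_ `^ _).
  rewrite /q natrM natrD natrM.
  have x0 : m.+3%:R != 0 :> R by rewrite pnatr_eq0.
  have -> : m.+2%:R = m.+3%:R - 1 :> R by rewrite -(natr1 m.+2); ring.
  have -> : m.+1%:R = m.+3%:R - 2 :> R by rewrite -(natr1 m.+2) -(natr1 m.+1); ring.
  have -> : m%:R = m.+3%:R - 3 :> R by rewrite -(natr1 m.+2) -(natr1 m.+1) -(natr1 m); ring.
  by set x := m.+3%:R in x0 *; clearbody x; field.
by ring.
Qed.

End final.

Theorem theorem3p4 (R : realType) (n : nat) (hn : (2 <= n)%N) :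
  Kstar R n ((n%:R + 2) / (n%:R + 1))%:E ((n%:R + 2) / (2 * n%:R))%:E.
Proof.
rewrite /Kstar hoelder_conjugate_exponent//.
case: n hn => [//|m] m0; rewrite ltnS in m0; rewrite succnK.
have nE : m.+1%:R + 2 = m.+3%:R :> R by rewrite -natrD addn2.
have nE1 : m.+1%:R + 1 = m.+2%:R :> R by rewrite natr1.
rewrite nE nE1.
set r := m.+3%:R / (2 * m.+1%:R); set s := m.+3%:R / m.+2%:R.
have r0 : 0 < r by rewrite divr_gt0// mulr_gt0.
have rV0 : 0 <= r^-1 by rewrite invr_ge0 ltW.
exists 1 => [|K eps K0 eps0]; first exact: ltr01.
pose kappa := Num.min 1 (m%:R * K)^-1.
have kappa0 : 0 < kappa by rewrite lt_min ltr01 invr_gt0 mulr_gt0// ltr0n.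
have kappa1 : kappa <= 1 by rewrite ge_min lexx.
have [cL cL0 polylog] := polylog_le 6 eps0 rV0.
pose c := sum_const m kappa; have c0 : 0 < c := sum_const_gt0 m kappa0.
exists (c `^ r^-1 * (cL * 2 `^ eps)).
  by rewrite mulr_gt0 ?mulr_gt0 ?powR_gt0.
move=> d E E1 E2 f g /andP[d0 d1] [Ecube Esep _] /andP[hd _] f0 g0 fE gE.
have [L /andP[dL dL2]] := exists_dyadic_scale (introT andP (conj d0 d1)).
have Ecube' (w : E) : cube (val w) by apply: Ecube; exact: (valP w).
have fg := set_dist_transverse m0 K0 hd fE gE.
have le1 := bilinear_sum_le m0 d0 (ltW d1) dL Ecube' Esep kappa0 kappa1 f0 g0 fg.
have fps0 (h : E * E -> R) : 0 <= \sum_w (\sum_i h (w, i)) `^ s.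
  by apply: sumr_ge0 => w _; exact: powR_ge0.
have le2 := le_trans le1 (sum_bound_le m kappa0 L d0 (fps0 f) (fps0 g)).
rewrite !mixed_norm_L1// unlock/= (integral_Xstar_powR (ltW d1) Ecube' f0 g0).
rewrite poweR_EFin lee_fin.
set S := \sum_(x : {set _}) _ in le2 *.
set A1 := \sum_w _ in le2 *; set A2 := \sum_w _ in le2 *.
have S0 : 0 <= S.
  apply: sumr_ge0 => x _; rewrite mulr_ge0 ?powR_ge0//; exact: vol_ge0.
set Z := _ `^ _ in le2; have Z0 : 0 <= Z by exact: powR_ge0.
apply: (@le_trans _ _ ((c * L.+1%:R ^+ 6 * Z) `^ r^-1)).
  by apply: ge0_ler_powR => //; rewrite nnegrE// (le_trans S0).
have l6 : 0 <= L.+1%:R ^+ 6 :> R by rewrite exprn_ge0.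
rewrite (powRM _ (mulr_ge0 (ltW c0) l6) Z0) (powRM _ (ltW c0) l6).
have hL : (L.+1%:R ^+ 6) `^ r^-1 <= cL * 2 `^ eps * d `^ (- eps).
  apply: le_trans (polylog L) _; rewrite -mulrA ler_wpM2l ?(ltW cL0)//.
  have -> : 2 `^ eps * d `^ (- eps) = (2 / d) `^ eps.
    by rewrite powRM ?invr_ge0 ?(ltW d0)// -powR_inv1 ?(ltW d0)// -powRrM mulN1r.
  apply: ge0_ler_powR; rewrite ?nnegrE ?divr_ge0 ?exprn_ge0 ?(ltW d0) ?(ltW eps0)//.
  by rewrite ler_pdivlMr// mulrC.
rewrite /Z bilinear_power_identity ?fps0//.
set P := (X in _ * X <= _); have P0 : 0 <= P by rewrite !mulr_ge0 ?powR_ge0.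
apply: (@le_trans _ _ (c `^ r^-1 * (cL * 2 `^ eps * d `^ (- eps)) * P)).
  by rewrite ler_wpM2r// ler_wpM2l// powR_ge0.
by rewrite /P !mulrA.
Qed.
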